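(* Let $J$ and $R$ be anti-commuting fundamental symmetries in a Hilbert space $\mathfrak{H}$, let $S$ be a simple, densely defined symmetric operator in $\mathfrak{H}$ with defect numbers $\langle 2,2\rangle$ such that $[S,J]=[S,R]=0$, and assume that $\Upsilon\neq\emptyset$. Fix a boundary triplet $(\mathcal{H},\Gamma_0,\Gamma_1)$ for $S^*$ such that the formulas $\mathcal{J}\Gamma_j=\Gamma_jJ$, $\mathcal{R}\Gamma_j=\Gamma_jR$ ($j=0,1$) correctly define operators $\mathcal{J},\mathcal{R}$ in $\mathcal{H}$, and an orthonormal basis of the two-dimensional space $\mathcal{H}$ in which $\mathcal{J},\mathcal{R},i\mathcal{R}\mathcal{J}$ have the matrices $\sigma_3,\sigma_1,\sigma_2$, respectively. For $\zeta\in\mathbb{R}$, $\phi\in[0,\pi]$, $\xi,\omega\in[0,2\pi)$ let $$\mathcal{K}(\zeta,\phi,\xi,\omega)=e^{-i\xi}\begin{pmatrix}-e^{-i\phi}\cosh\zeta & e^{-i\omega}\sinh\zeta\\ -e^{i\omega}\sinh\zeta & e^{i\phi}\cosh\zeta\end{pmatrix},$$ and for $\mathcal{K}=\mathcal{K}(\zeta,\phi,\xi,\omega)$ let $A_{\mathcal{K}}\in\Sigma_J$ be the operator $$A_{\mathcal{K}}=S^*\upharpoonright\{f\in\mathcal{D}(S^* ) : \mathcal{K}(\Gamma_1+i\Gamma_0)f=(\Gamma_1-i\Gamma_0)f\}.$$ Then: (i) the adjoint $A_{\mathcal{K}}^*\in\Sigma_J$ of $A_{\mathcal{K}}$, $\mathcal{K}=\mathcal{K}(\zeta,\phi,\xi,\omega)$,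 is $A_{\mathcal{K}'}$ with $\mathcal{K}'=\mathcal{K}(-\zeta,\phi,\xi,\omega)$; (ii) $A_{\mathcal{K}}$ is self-adjoint if and only if $\zeta=0$, i.e. $\mathcal{K}=e^{-i\xi}\begin{pmatrix}-e^{-i\phi}&0\\0&e^{i\phi}\end{pmatrix}$; (iii) $A_{\mathcal{K}}$ belongs to $\Sigma_J^{\mathsf{st}}\setminus\Upsilon$ if and only if $\mathcal{K}=\mathcal{K}(\zeta,\phi,\xi,\omega)$ with $|\tanh\zeta|<|\cos\phi|$; (iv) $A_{\mathcal{K}}$ belongs to $\Upsilon$ if and only if $\zeta=0$ and $\phi=\pi/2$, i.e. $\mathcal{K}=\begin{pmatrix}ie^{-i\xi}&0\\0&ie^{-i\xi}\end{pmatrix}$. Furthermore, if $|\tanh\zeta|<|\cos\phi|$, then the operator $A_{\mathcal{K}(\zeta,\phi,\xi,\omega)}$ has the $C_{\chi,\omega}$-symmetry (i.e. it commutes with $C_{\chi,\omega}$), where $\chi\in\mathbb{R}$ is uniquely determined by the equation $\cos\phi\,\tanh\chi=-\tanh\zeta$ and $$C_{\chi,\omega}=J[(\cosh\chi)I+(\sinh\chi)R_\omega],\qquad R_\omega=Re^{i\omega J}.$$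
   Context: $\mathfrak{H}$ is a Hilbert space with inner product $(\cdot,\cdot)$. A fundamental symmetry is a bounded operator $J$ with $J=J^*$, $J^2=I$; $J,R$ anti-commute if $JR+RJ=0$. For a bounded operator $C$ and an operator $A$, $[A,C]=0$ (''$A$ commutes with $C$'') means $AC=CA$ (including equality of domains). $\{C_\alpha\}_{\alpha\in D}$ denotes the set (indexed by a set $D$) of all bounded operators $C$ in $\mathfrak{H}$ with $C^2=I$, $JC>0$ (i.e. $JC$ is self-adjoint and $(JCx,x)>0$ for $x\neq0$) and $SC=CS$. An operator $A$ is $J$-self-adjoint if it is densely defined and $A^*J=JA$. $\Sigma_J$ is the set of $J$-self-adjoint extensions $A\supset S$; $\Sigma_J^{\mathsf{st}}$ is the set of $A\in\Sigma_J$ with $[A,C_\alpha]=0$ for at least one $\alpha\in D$; $\Upsilon$ is the set of $A\in\Sigma_J$ with $[A,C_\alpha]=0$ for all $\alpha\in D$. $S$ is simple if the closed linear span of $\bigcup_{\mu\in\mathbb{C}\setminus\mathbb{R}}\ker(S^*-\mu I)$ is $\mathfrak{H}$. Defect numbers $\langle2,2\rangle$ means $\dim\ker(S^*-\mu I)=2$ for all $\mu\in\mathbb{C}\setminus\mathbb{R}$. A boundary triplet for $S^*$ is a triplet $(\mathcal{H},\Gamma_0,\Gamma_1)$, where $\mathcal{H}$ is a Hilbert space and $\Gamma_0,\Gamma_1:\mathcal{D}(S^* )\to\mathcal{H}$ are linear, such that $(S^*x,y)-(x,S^*y)=(\Gamma_1x,\Gamma_0y)_{\mathcal{H}}-(\Gamma_0x,\Gamma_1y)_{\mathcal{H}}$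 for all $x,y\in\mathcal{D}(S^* )$ and $(\Gamma_0,\Gamma_1):\mathcal{D}(S^* )\to\mathcal{H}\oplus\mathcal{H}$ is surjective. Under the stated hypotheses a boundary triplet with the required intertwining operators exists; $\mathcal{J},\mathcal{R}$ are anti-commuting fundamental symmetries in $\mathcal{H}$, $\dim\mathcal{H}=2$, and a basis as required exists. The matrices $\mathcal{K}(\zeta,\phi,\xi,\omega)$ are exactly the $\mathcal{J}$-unitary operators in $\mathcal{H}$ (those with $\mathcal{K}^*\mathcal{J}\mathcal{K}=\mathcal{J}$), and for these $A_{\mathcal{K}}$ is $J$-self-adjoint. Pauli matrices: $\sigma_1=\begin{pmatrix}0&1\\1&0\end{pmatrix}$, $\sigma_2=\begin{pmatrix}0&-i\\i&0\end{pmatrix}$, $\sigma_3=\begin{pmatrix}1&0\\0&-1\end{pmatrix}$. *)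

(* Defs.v *)
From HB Require Import structures.
From mathcomp Require Import all_boot all_order all_algebra.
From mathcomp Require Import complex.
From mathcomp Require Import boolp classical_sets functions reals.
From mathcomp Require Import topology normedtype sequences exp trigo.
Import Order.TTheory GRing.Theory Num.Theory.
Import numFieldNormedType.Exports.

Set Implicit Arguments.
Unset Strict Implicit.
Unset Printing Implicit Defensive.

Local Open Scope complex_scope.
Local Open Scope classical_set_scope.
Local Open Scope ring_scope.

(* Complex Hilbert spaces. By the type [{dot H for Num.conj}] the inner product
   is linear in its first argument and conjugate-linear in its second one. *)
HB.mixin Record isHilbert (R : realType) H of CompleteNormedModule R[i] H := {
  inner : {dot H for (@Num.conj R[i])};
  inner_norm : forall x : H, inner x x = `|x| ^+ 2
}.

#[short(type="hilbertType")]
HB.structure Definition Hilbert (R : realType) :=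
  {H of CompleteNormedModule R[i] H & isHilbert R H}.

Section Subspaces.
Variables (R : realType) (V : lmodType R[i]).
Implicit Types D : set V.

Definition is_subspace D :=
  D 0 /\ forall (a : R[i]) x y, D x -> D y -> D (a *: x + y).

Definition has_dim D (n : nat) := exists e : 'I_n -> V,
  (forall c : 'I_n -> R[i],
     \sum_(i < n) c i *: e i = 0 -> forall i, c i = 0) /\
  D = [set v | exists c : 'I_n -> R[i], v = \sum_(i < n) c i *: e i].

End Subspaces.

(* A (possibly unbounded) operator in H is represented by its graph, a subset
   of H * H, so that Leibniz equality of graphs is equality of operators,
   including equality of domains. Everywhere defined operators are functions
   H -> H and are turned into graphs by [op_graph]. *)
Section Operators.
Variables (R : realType) (H : hilbertType R).
Implicit Types (A B : set (H * H)) (C T : H -> H) (D : set H).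

Definition is_operator A := is_subspace A /\
  forall x y z, A (x, y) -> A (x, z) -> y = z.

Definition op_graph T : set (H * H) := [set p | p.2 = T p.1].

Definition op_dom A : set H := [set x | exists y, A (x, y)].

Definition densely_defined A := dense (op_dom A).

(* the product AB, with domain {x in dom B | B x in dom A} *)
Definition op_comp A B : set (H * H) :=
  [set p | exists z, B (p.1, z) /\ A (z, p.2)].

Definition op_restrict A D : set (H * H) := [set p | A p /\ D p.1].

Definition op_adjoint A : set (H * H) :=
  [set p | forall q, A q -> inner q.2 p.1 = inner q.1 p.2].

Definition self_adjoint A := op_adjoint A = A.

Definition symmetric_op A := is_operator A /\ A `<=` op_adjoint A.

Definition commutes A C :=
  op_comp A (op_graph C) = op_comp (op_graph C) A.

(* ker (A - mu I) *)
Definition ker_shift A (mu : R[i]) : set H := [set x | A (x, mu *: x)].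

Definition has_defect_numbers A (n : nat) := forall mu : R[i],
  mu \isn't Num.real -> has_dim (ker_shift (op_adjoint A) mu) n.

Definition simple_op A :=
  closure (smallest (@is_subspace R H)
    (\bigcup_(mu in [set mu : R[i] | mu \isn't Num.real])
       ker_shift (op_adjoint A) mu)) = setT.

Definition bounded_op T :=
  (forall (a : R[i]) x y, T (a *: x + y) = a *: T x + T y) /\
  exists M : R, forall x, `|T x| <= M%:C * `|x|.

Definition positive_op T := self_adjoint (op_graph T) /\
  forall x, x != 0 -> 0 < inner (T x) x.

Definition fundamental_symmetry J :=
  [/\ bounded_op J, self_adjoint (op_graph J) & forall x, J (J x) = x].

Definition anti_commute J K := forall x : H, J (K x) + K (J x) = 0.

Definition op_exp T (x : H) : H :=
  limn [series (k`!%:R : R[i])^-1 *: iter k T x]_k.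

End Operators.

Section Extensions.
Variables (R : realType) (H : hilbertType R).
Variables (S : set (H * H)) (J : H -> H).
Implicit Types (A : set (H * H)) (C : H -> H).

(* the set {C_alpha} *)
Definition C_set : set (H -> H) :=
  [set C | [/\ bounded_op C, forall x, C (C x) = x,
               positive_op (J \o C) & commutes S C]].

Definition J_self_adjoint A := [/\ is_operator A, densely_defined A &
  op_comp (op_adjoint A) (op_graph J) = op_comp (op_graph J) A].

Definition Sigma_J : set (set (H * H)) :=
  [set A | J_self_adjoint A /\ S `<=` A].

Definition Sigma_J_st : set (set (H * H)) :=
  [set A | Sigma_J A /\ exists2 C, C_set C & commutes A C].

Definition Upsilon : set (set (H * H)) :=
  [set A | Sigma_J A /\ forall C, C_set C -> commutes A C].

End Extensions.

Section BoundaryTriplets.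
Variables (R : realType) (H G : hilbertType R).
Implicit Types S : set (H * H).

Definition linear_on (D : set H) (f : H -> G) := forall (a : R[i]) x y,
  D x -> D y -> f (a *: x + y) = a *: f x + f y.

(* Only the values of Gam0 and Gam1 on the domain of the adjoint matter. *)
Definition boundary_triplet S (Gam0 Gam1 : H -> G) :=
  [/\ linear_on (op_dom (op_adjoint S)) Gam0,
      linear_on (op_dom (op_adjoint S)) Gam1,
      forall p q, op_adjoint S p -> op_adjoint S q ->
        inner p.2 q.1 - inner p.1 q.2 =
        inner (Gam1 p.1) (Gam0 q.1) - inner (Gam0 p.1) (Gam1 q.1) &
      forall g0 g1, exists2 f, op_dom (op_adjoint S) f &
        Gam0 f = g0 /\ Gam1 f = g1].

Definition intertwines S (Gam : H -> G) (T : H -> H) (T' : G -> G) :=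
  forall f, op_dom (op_adjoint S) f -> T' (Gam f) = Gam (T f).

Definition op_A S (Gam0 Gam1 : H -> G) (K : G -> G) : set (H * H) :=
  op_restrict (op_adjoint S)
    [set f | K (Gam1 f + 'i *: Gam0 f) = Gam1 f - 'i *: Gam0 f].

End BoundaryTriplets.

Section Matrices.
Variables (R : realType) (G : hilbertType R).

Definition orthonormal_basis n (e : 'I_n -> G) :=
  (forall i j, inner (e i) (e j) = (i == j)%:R) /\
  (forall g, exists c : 'I_n -> R[i], g = \sum_(i < n) c i *: e i).

(* The operator with matrix M in the orthonormal basis e; the coordinates of
   g in this basis are the numbers inner g (e j). *)
Definition mx_op n (e : 'I_n -> G) (M : 'M[R[i]]_n) (g : G) : G :=
  \sum_(i < n) (\sum_(j < n) M i j * inner g (e j)) *: e i.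

Definition mx22 (a b c d : R[i]) : 'M[R[i]]_2 :=
  \matrix_(i, j) nth 0 (nth [::] [:: [:: a; b]; [:: c; d]] i) j.

Definition sigma1 : 'M[R[i]]_2 := mx22 0 1 1 0.
Definition sigma2 : 'M[R[i]]_2 := mx22 0 (- 'i) 'i 0.
Definition sigma3 : 'M[R[i]]_2 := mx22 1 0 0 (-1).

End Matrices.

Section KandC.
Variable R : realType.

Definition cosh (x : R) : R := (expR x + expR (- x)) / 2.
Definition sinh (x : R) : R := (expR x - expR (- x)) / 2.
Definition tanh (x : R) : R := sinh x / cosh x.

(* e^{it} for real t *)
Definition expi (t : R) : R[i] := cos t +i* sin t.

Definition Kmx (zeta phi xi omega : R) : 'M[R[i]]_2 :=
  expi (- xi) *:
    mx22 (- (expi (- phi) * (cosh zeta)%:C)) (expi (- omega) * (sinh zeta)%:C)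
         (- (expi omega * (sinh zeta)%:C)) (expi phi * (cosh zeta)%:C).

Variable H : hilbertType R.

Definition R_omega (J K : H -> H) (omega : R) (x : H) : H :=
  K (op_exp (fun y => ('i * omega%:C) *: J y) x).

Definition C_chi_omega (J K : H -> H) (chi omega : R) (x : H) : H :=
  J ((cosh chi)%:C *: x + (sinh chi)%:C *: R_omega J K omega x).

End KandC.

(* Main.v *)
(** Every C in the set {C_alpha} is a combination of I, J, R, JR. Take A0 in
    Upsilon: it is self-adjoint and invariant under J and R, so its domain is
    the kernel, inside D(S^* ), of a single map B = conj(a1) Gam0 - conj(a0) Gam1.
    As C preserves D(A0), it acts through B as a constant 2x2 matrix. Since A0
    has no non-real eigenvalue, B is injective on each ker(S^* - mu), so there
    C coincides with the combination T of I, J, R, JR having the same matrix;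
    S being simple, C = T. The conditions C^2 = I and JC > 0 then force the
    matrix (p, q; -conj q, -p) with p > 0 and p^2 = 1 + |q|^2.

    An operator acting on both boundary values by a matrix M commutes with A_K
    iff KM = MK, and the adjoint of A_K is A_{K'} as soon as K' K^* = I, so all
    the claims become statements about 2x2 matrices. *)

Require Import Defs.
From mathcomp Require Import all_boot all_order all_algebra.
From mathcomp Require Import complex.
From mathcomp Require Import boolp classical_sets functions reals.
From mathcomp Require Import topology normedtype sequences exp trigo.
From mathcomp Require Import ring lra.
Import Order.TTheory GRing.Theory Num.Theory.
Import numFieldNormedType.Exports.

Set Implicit Arguments.
Unset Strict Implicit.
Unset Printing Implicit Defensive.

Local Open Scope complex_scope.
Local Open Scope classical_set_scope.
Local Open Scope ring_scope.

(** * Inner products in a complex Hilbert space *)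

Section InnerProduct.
Variables (R : realType) (H : hilbertType R).
Implicit Types (x y z : H) (a : R[i]).

Lemma innerDl x y z : inner (x + y) z = inner x z + inner y z.
Proof. exact: linearDl. Qed.

Lemma innerDr x y z : inner x (y + z) = inner x y + inner x z.
Proof. exact: linearDr. Qed.

Lemma innerNl x z : inner (- x) z = - inner x z.
Proof. exact: linearNl. Qed.

Lemma innerNr x z : inner x (- z) = - inner x z.
Proof. exact: linearNr. Qed.

Lemma innerZl a x z : inner (a *: x) z = a * inner x z.
Proof. exact: linearZl_LR. Qed.

Lemma innerZr a x z : inner x (a *: z) = a^* * inner x z.
Proof. exact: linearZr_LR. Qed.

Lemma inner0l z : inner (0 : H) z = 0.
Proof. exact: linear0l. Qed.

Lemma inner0r z : inner z (0 : H) = 0.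
Proof. exact: linear0r. Qed.

Lemma innerC x y : inner y x = (inner x y)^*.
Proof. by rewrite hermC expr0 mul1r. Qed.

Lemma inner_ge0 x : 0 <= inner x x.
Proof. by rewrite inner_norm exprn_ge0. Qed.

Lemma inner_eq0 x : inner x x = 0 -> x = 0.
Proof.
by rewrite inner_norm => /eqP; rewrite expf_eq0 /= normr_eq0 => /eqP.
Qed.

Lemma inner_gt0 x : x != 0 -> 0 < inner x x.
Proof.
by move=> x0; rewrite lt_def inner_ge0 andbT; apply: contra_neq x0; exact: inner_eq0.
Qed.

Lemma inner_extr x y : (forall z, inner z x = inner z y) -> x = y.
Proof.
move=> h; apply/subr0_eq/inner_eq0.
by rewrite innerDr innerNr h subrr.
Qed.

End InnerProduct.

(** * Graphs of unbounded operators, and bounded operators *)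

Section OperatorGraphs.
Variables (R : realType) (H : hilbertType R).
Implicit Types (A B : set (H * H)) (C T : H -> H).

Lemma subspace0 (V : lmodType R[i]) (D : set V) : is_subspace D -> D 0.
Proof. by case. Qed.

Lemma subspaceZ (V : lmodType R[i]) (D : set V) a x :
  is_subspace D -> D x -> D (a *: x).
Proof. by move=> [D0 DD] Dx; rewrite -[_ *: _]addr0; exact: DD. Qed.

Lemma subspaceD (V : lmodType R[i]) (D : set V) x y :
  is_subspace D -> D x -> D y -> D (x + y).
Proof. by move=> [D0 DD] Dx Dy; rewrite -[x]scale1r; exact: DD. Qed.

Lemma op_adjoint_subspace A : is_subspace (op_adjoint A).
Proof.
split=> [q _ /=|a p p' Ap Ap' q Aq /=]; first by rewrite !inner0r.
by rewrite !innerDr !innerZr (Ap _ Aq) (Ap' _ Aq).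
Qed.

Lemma op_adjointS A B : A `<=` B -> op_adjoint B `<=` op_adjoint A.
Proof. by move=> AB p Bp q /AB; exact: Bp. Qed.

(** If w is nonzero, density gives x in D with |w - x| < |w|, whereas orthogonality gives |w - x|^2
    = |w|^2 + |x|^2. *)
Lemma orth_dense (D : set H) (w : H) :
  dense D -> (forall x, D x -> inner x w = 0) -> w = 0.
Proof.
move=> Dd Dw; have [//|w0] := eqVneq w 0.
have wn : 0 < `|w| by rewrite normr_gt0.
have [||x [xw Dx]] := Dd (ball w `|w|).
- by exists w; exact: ballxx.
- exact: ball_open.
move: xw; rewrite -ball_normE /= => xw.
have : `|w| ^+ 2 <= `|w - x| ^+ 2.
  rewrite -!inner_norm !(innerDl, innerDr, innerNl, innerNr).
  rewrite (Dw _ Dx) (innerC x w) (Dw _ Dx) conjC0 !(subr0, oppr0, addr0, opprK).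
  by rewrite add0r lerDl inner_ge0.
by rewrite ler_sqr ?nnegrE // => /(lt_le_trans xw); rewrite ltxx.
Qed.

Lemma op_adjoint_fun A x y z : densely_defined A ->
  op_adjoint A (x, y) -> op_adjoint A (x, z) -> y = z.
Proof.
move=> Ad Ay Az; apply/subr0_eq; apply: (orth_dense Ad) => u [v Auv].
by move: (Ay _ Auv) (Az _ Auv) => /= Ey Ez; rewrite innerDr innerNr -Ey -Ez subrr.
Qed.

(** An involution can be moved to the other side, so an equality of products, domains included,
    amounts to two implications between graphs. The case B = A gives commutation, the case B = A^*
    gives J-self-adjointness. *)
Lemma op_comp_graphP A B C : (forall x, C (C x) = x) ->
  op_comp B (op_graph C) = op_comp (op_graph C) A <->
  (forall x y, A (x, y) -> B (C x, C y)) /\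
  (forall x y, B (x, y) -> A (C x, C y)).
Proof.
move=> CK; split=> [AC|[AB BA]].
  split=> x y.
    move=> Axy; have : op_comp (op_graph C) A (x, C y) by exists y.
    by rewrite -AC => -[z [zE Az]]; rewrite -[C x]zE.
  move=> Bxy; have : op_comp B (op_graph C) (C x, y).
    by exists x; split=> //; rewrite /op_graph /= CK.
  by rewrite AC => -[z [Az zE]]; rewrite [y]zE /= CK.
apply/seteqP; split=> -[x y] [z [zE Az]].
  exists (C y); split; last by rewrite /op_graph /= CK.
  by rewrite -[x]CK -[C x]zE; exact: BA.
by exists (C x); split => //; rewrite [(x, y).2]Az; exact: AB.
Qed.

Lemma commutesP A C : (forall x, C (C x) = x) ->
  commutes A C <-> (forall x y, A (x, y) -> A (C x, C y)).
Proof. by move=> /(op_comp_graphP A A) h; split=> [/h[]|AC] //; exact/h. Qed.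

Lemma op_adjoint_invariant A T T' :
  (forall x y, inner (T x) y = inner x (T' y)) ->
  (forall x y, A (x, y) -> A (T x, T y)) ->
  forall x y, op_adjoint A (x, y) -> op_adjoint A (T' x, T' y).
Proof.
move=> TT' AT x y Axy [u v] /AT /Axy /=.
by rewrite !TT'.
Qed.

Lemma self_adjoint_graphP T :
  self_adjoint (op_graph T) <-> (forall x y, inner (T x) y = inner x (T y)).
Proof.
split=> [sT x y|sT].
  have : op_adjoint (op_graph T) (y, T y) by rewrite sT.
  by move=> /(_ (x, T x)); exact.
apply/seteqP; split=> -[x y] /=.
  move=> Txy; apply: inner_extr => z.
  by rewrite -sT; exact/esym/(Txy (z, T z)).
by rewrite /op_graph /= => -> [u v] /= ->; exact: sT.
Qed.

Lemma bounded_opM T T' : bounded_op T -> bounded_op T' -> bounded_op (T \o T').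
Proof.
move=> [Tl [M TM]] [Tl' [M' TM']]; split=> [a x y|]; first by rewrite /= Tl' Tl.
have M0 : `|M|%:C >= 0 by rewrite ler0c.
exists (`|M| * M') => x /=.
rewrite (le_trans (TM _)) //; apply: (@le_trans _ _ (`|M|%:C * `|T' x|)).
  by rewrite ler_wpM2r // lecR ler_norm.
by rewrite rmorphM /= -mulrA ler_wpM2l.
Qed.

Lemma bounded_opD T T' :
  bounded_op T -> bounded_op T' -> bounded_op (fun x => T x + T' x).
Proof.
move=> [Tl [M TM]] [Tl' [M' TM']]; split=> [a x y|].
  by rewrite Tl Tl' scalerDr addrACA.
exists (M + M') => x.
by rewrite rmorphD /= mulrDl (le_trans (ler_normD _ _)) // lerD.
Qed.

Lemma bounded_opZ a T : bounded_op T -> bounded_op (fun x => a *: T x).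
Proof.
move=> [Tl [M TM]]; split=> [b x y|].
  by rewrite Tl scalerDr !scalerA mulrC.
exists (complex.Re `|a| * M) => x.
have -> : (complex.Re `|a| * M)%:C = `|a| * M%:C.
  by rewrite rmorphM; congr (_ * _); rewrite RRe_real ?normr_real.
by rewrite normrZ -mulrA ler_wpM2l.
Qed.

Lemma bounded_op_id : bounded_op (@id H).
Proof. by split=> //; exists 1 => x; rewrite mul1r. Qed.

(** The kernel of D = T - T' is a subspace containing X, hence its span. A point x of the span close
    enough to z gives |D z| = |D (z - x)| < |D z| unless D z = 0. *)
Lemma bounded_op_eq_closure (X : set H) T T' : bounded_op T -> bounded_op T' ->
  (forall x, X x -> T x = T' x) ->
  closure (smallest (@is_subspace R H) X) = setT -> T = T'.
Proof.
move=> bT bT' TX clX; apply/funext => z; apply/subr0_eq.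
have [//|w0] := eqVneq (T z - T' z) 0.
pose D x := T x + - 1 *: T' x.
have [Dl [M DM]] : bounded_op D := bounded_opD bT (bounded_opZ (- 1) bT').
have DE x : D x = T x - T' x by rewrite /D scaleN1r.
have D0 : D 0 = 0.
  by rewrite -[X in D X](addNr 0) -scaleN1r Dl scaleN1r addNr.
have subD : smallest (@is_subspace R H) X `<=` [set x | D x = 0].
  apply: smallest_sub; last by move=> x /TX h; rewrite /= DE h subrr.
  by split=> // a x y /= hx hy; rewrite Dl hx hy scaler0 addr0.
(* The bound [M] may be zero or negative; a positive one is needed as a divisor. *)
pose N := `|M| + 1.
have N0 : 0 < N by rewrite ltr_pwDr.
have cz : closure (smallest (@is_subspace R H) X) z by rewrite clX.
have e0 : 0 < `|D z| / N%:C.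
  by rewrite divr_gt0 ?ltcR // normr_gt0 DE.
have [x [/subD /= Dx]] := cz _ (nbhsx_ballx z _ e0).
rewrite -ball_normE /= ltr_pdivlMr ?ltcR // mulrC => lt1.
have Dzx : D (z - x) = D z.
  by have := Dl (- 1) x z; rewrite Dx scaler0 add0r scaleN1r addrC.
have le1 : `|D z| <= N%:C * `|z - x|.
  rewrite -Dzx (le_trans (DM _)) // ler_wpM2r // lecR.
  by rewrite (le_trans (ler_norm M)) // lerDl.
by have := le_lt_trans le1 lt1; rewrite ltxx.
Qed.

End OperatorGraphs.

(** * Linearity rules for a bounded operator *)

Section BoundedLinear.
Variables (R : realType) (H : hilbertType R) (T : H -> H).
Hypothesis bT : bounded_op T.

Lemma bounded_op_lin (a : R[i]) x y : T (a *: x + y) = a *: T x + T y.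
Proof. by case: bT. Qed.

Lemma bounded_op0 : T 0 = 0.
Proof. by rewrite -[X in T X](addNr 0) -scaleN1r bounded_op_lin scaleN1r addNr. Qed.

Lemma bounded_opZE (a : R[i]) x : T (a *: x) = a *: T x.
Proof. by rewrite -[_ *: x]addr0 bounded_op_lin bounded_op0 addr0. Qed.

Lemma bounded_opDE x y : T (x + y) = T x + T y.
Proof. by rewrite -[x in LHS]scale1r bounded_op_lin scale1r. Qed.

End BoundedLinear.

(** * The algebra generated by two anti-commuting fundamental symmetries *)

Section Clifford.
Variables (R : realType) (H : hilbertType R) (J K : H -> H).

(** Since J and K anti-commute and square to I, these combinations are closed under products and
    adjoints. Identities between such operators thus reduce to identities between their four
    coefficients. *)
Definition clif (a b c d : R[i]) (x : H) : H :=
  a *: x + b *: J x + c *: K x + d *: J (K x).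

Hypotheses (hJ : fundamental_symmetry J) (hK : fundamental_symmetry K).
Hypothesis hJK : anti_commute J K.
Implicit Types (a b c d : R[i]) (x y : H).

Lemma fundsym_bounded T : @fundamental_symmetry R H T -> bounded_op T.
Proof. by case. Qed.

Lemma fundsymK T : @fundamental_symmetry R H T -> forall x, T (T x) = x.
Proof. by case. Qed.

Lemma fundsym_inner T : @fundamental_symmetry R H T ->
  forall x y, inner (T x) y = inner x (T y).
Proof. by case=> _ /self_adjoint_graphP. Qed.

Let bJ := fundsym_bounded hJ.
Let bK := fundsym_bounded hK.

Lemma anti_commuteE x : K (J x) = - J (K x).
Proof. by apply/eqP; rewrite -addr_eq0 addrC hJK. Qed.

Lemma clif_bounded a b c d : bounded_op (clif a b c d).
Proof.
by do !apply: bounded_opD; apply: bounded_opZ => //;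
  [exact: bounded_op_id | exact: (bounded_opM bJ bK)].
Qed.

Lemma clifD a b c d a' b' c' d' x :
  clif a b c d x + clif a' b' c' d' x = clif (a + a') (b + b') (c + c') (d + d') x.
Proof.
rewrite /clif !scalerDl.
by rewrite [LHS](AC (4 * 4) ((1 * 5) * (2 * 6) * (3 * 7) * (4 * 8))).
Qed.

Lemma clifZ k a b c d x :
  k *: clif a b c d x = clif (k * a) (k * b) (k * c) (k * d) x.
Proof. by rewrite /clif !scalerDr !scalerA. Qed.

Lemma J_clif a b c d x : J (clif a b c d x) = clif b a d c x.
Proof.
rewrite /clif !(bounded_opDE bJ) !(bounded_opZE bJ) !(fundsymK hJ).
by rewrite [LHS](AC (1*1*1*1) (2*1*4*3)).
Qed.

Lemma K_clif a b c d x : K (clif a b c d x) = clif c (- d) a (- b) x.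
Proof.
rewrite /clif !(bounded_opDE bK) !(bounded_opZE bK) !anti_commuteE !(fundsymK hK).
by rewrite !scalerN !scaleNr [LHS](AC (1*1*1*1) (3*4*1*2)).
Qed.

(** The signs come from KJ = -JK; in particular JK squares to -I. *)
Lemma clif_comp a b c d a' b' c' d' x :
  clif a b c d (clif a' b' c' d' x) =
  clif (a * a' + b * b' + c * c' - d * d') (a * b' + b * a' - c * d' + d * c')
       (a * c' + b * d' + c * a' - d * b') (a * d' + b * c' - c * b' + d * a') x.
Proof.
rewrite [LHS]/clif K_clif !J_clif !clifZ !clifD.
by congr clif; ring.
Qed.

Lemma clif_id x : clif 1 0 0 0 x = x.
Proof. by rewrite /clif !scale0r !addr0 scale1r. Qed.

Lemma clif_J x : clif 0 1 0 0 x = J x.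
Proof. by rewrite /clif !scale0r !addr0 add0r scale1r. Qed.

(** The sign of the last coefficient comes from the adjoint of JK being KJ = -JK. *)
Lemma inner_clif a b c d x y :
  inner (clif a b c d x) y = inner x (clif a^* b^* c^* (- d^*) y).
Proof.
rewrite /clif !(innerDl, innerDr) !(innerZl, innerZr) !rmorphN !conjCK.
rewrite -!(fundsym_inner hJ) -!(fundsym_inner hK) anti_commuteE innerNl.
by rewrite /= conjCK mulrNN.
Qed.

Lemma clif_graph (A : set (H * H)) a b c d x y : is_subspace A ->
  (forall x y, A (x, y) -> A (J x, J y)) ->
  (forall x y, A (x, y) -> A (K x, K y)) ->
  A (x, y) -> A (clif a b c d x, clif a b c d y).
Proof.
move=> sA AJ AK Axy; rewrite /clif.
have -> : (a *: x + b *: J x + c *: K x + d *: J (K x),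
           a *: y + b *: J y + c *: K y + d *: J (K y)) =
  a *: (x, y) + b *: (J x, J y) + c *: (K x, K y) + d *: (J (K x), J (K y)) by [].
by do !apply: subspaceD => //; apply: subspaceZ => //; do ?apply: AJ; do ?apply: AK.
Qed.

End Clifford.

(** * Euler's formula for a fundamental symmetry *)

Section ComplexExponential.
Variables (R : realType) (H : hilbertType R) (J : H -> H).
Hypothesis hJ : fundamental_symmetry J.

(** As J^2 = I, the even powers of itJ are real multiples of I and the odd ones are imaginary
    multiples of J; for each parity one of the two trigonometric coefficients vanishes. *)
Lemma exp_term (t : R) k (x : H) :
  (k`!%:R : R[i])^-1 *: iter k (fun y => ('i * t%:C) *: J y) x =
  (cos_coeff t k)%:C *: x + ('i * (sin_coeff t k)%:C) *: J x.
Proof.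
have bJ := fundsym_bounded hJ.
have iterE m : iter m.*2 (fun y => ('i * t%:C) *: J y) x =
    ((-1) ^+ m * t%:C ^+ m.*2) *: x.
  elim: m => [|m IH]; first by rewrite /= expr0 mulr1 scale1r.
  rewrite doubleS /= IH !(bounded_opZE bJ) (fundsymK hJ) !scalerA; congr (_ *: _).
  rewrite !exprS; move: ((-1) ^+ m) => u; rewrite -[in RHS]sqrCi; ring.
have fE (n : nat) : (n%:R)%:C = n%:R :> R[i] by rewrite rmorph_nat.
have VE (n : nat) : (n%:R^-1)%:C = n%:R^-1 :> R[i] by rewrite fmorphV /= fE.
have kE := odd_double_half k; move: kE; case: (odd k) => <-.
  rewrite add1n /= iterE (bounded_opZE bJ) /cos_coeff /sin_coeff /= odd_double /=.
  rewrite !mul0r rmorph0 scale0r add0r !scalerA doubleK mul1r; congr (_ *: _).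
  rewrite !rmorphM !rmorphXn !rmorphN rmorph1 /= VE exprS; ring.
rewrite add0n iterE scalerA /cos_coeff /sin_coeff /= odd_double /=.
rewrite !mul0r rmorph0 mulr0 scale0r addr0 doubleK mul1r; congr (_ *: _).
rewrite -exprnP !rmorphM !rmorphXn !rmorphN rmorph1 /= VE; ring.
Qed.

Lemma op_exp_fundsym (t : R) (x : H) :
  op_exp (fun y => ('i * t%:C) *: J y) x =
  (cos t)%:C *: x + ('i * (sin t)%:C) *: J x.
Proof.
pose C : numFieldType := R[i].
have realC (u : R^nat) (l : R) : u @ \oo --> l ->
    (fun n => (u n)%:C : C) @ \oo --> (l%:C : C).
  move=> /cvgrPdist_lt ul; apply/cvgrPdist_lt => e e0.
  (* A positive element of [R[i]] is real, so it also serves as the tolerance for the real limit. *)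
  have e0' : 0 < complex.Re e by move: e0; rewrite ltcE => /andP[].
  have eE : (complex.Re e)%:C = e by rewrite RRe_real // gtr0_real.
  near=> n; rewrite -rmorphB /= -eE normc_def /= expr0n addr0 sqrtr_sqr ltcR.
  by near: n; exact: ul.
apply/cvg_lim => //.
have -> : [series (k`!%:R : R[i])^-1 *: iter k (fun y => ('i * t%:C) *: J y) x]_k =
    (fun n => (series (cos_coeff t) n)%:C *: x +
              ('i * (series (sin_coeff t) n)%:C) *: J x).
  apply/funext => n; rewrite /series /=.
  rewrite !rmorph_sum /= mulr_sumr !scaler_suml -big_split /=.
  by apply: eq_bigr => k _; exact: exp_term.
apply: cvgD; apply: cvgZr_tmp.
  by apply: realC; rewrite unlock; exact: is_cvg_series_cos_coeff.
apply: cvgMl_tmp; apply: realC; rewrite unlock; exact: is_cvg_series_sin_coeff.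
Unshelve. all: by end_near. Qed.

End ComplexExponential.

(** * Hyperbolic functions *)

Section Hyperbolic.
Variable R : realType.
Implicit Types x y t : R.

Lemma cosh2_sinh2 x : cosh x ^+ 2 - sinh x ^+ 2 = 1.
Proof.
have := expRxMexpNx_1 x; rewrite /cosh /sinh => h.
by rewrite -[RHS]h; field.
Qed.

Lemma cosh_gt0 x : 0 < cosh x.
Proof. by rewrite divr_gt0 // addr_gt0 // expR_gt0. Qed.

Lemma coshN x : cosh (- x) = cosh x.
Proof. by rewrite /cosh opprK addrC. Qed.

Lemma sinhN x : sinh (- x) = - sinh x.
Proof. by rewrite /sinh opprK -mulNr opprB. Qed.

Lemma cosh0 : cosh 0 = 1 :> R.
Proof. by rewrite /cosh oppr0 expR0; field. Qed.

Lemma sinh0 : sinh 0 = 0 :> R.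
Proof. by rewrite /sinh oppr0 subrr mul0r. Qed.

(** This form is a homographic function of e^{2x}, from which injectivity and the inverse function
    are read off. *)
Lemma tanhE x : tanh x = (expR (x *+ 2) - 1) / (expR (x *+ 2) + 1).
Proof.
rewrite /tanh /sinh /cosh mulr2n expRD expRN.
have := expR_gt0 x; set u := expR x => u0.
have n0 : u * u + 1 != 0 by apply: lt0r_neq0; rewrite addr_gt0 ?mulr_gt0.
by field; rewrite n0 lt0r_neq0 //= andbT; apply: lt0r_neq0.
Qed.

Lemma tanh_inj : injective (@tanh R).
Proof.
move=> x y; rewrite !tanhE => h.
apply: (@mulIf _ 2%:R); first by rewrite pnatr_eq0.
rewrite !mulr_natr; apply: expR_inj.
have := expR_gt0 (x *+ 2); have := expR_gt0 (y *+ 2).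
move: h; set u := expR (x *+ 2); set v := expR _ => /eqP + v0 u0.
rewrite eqr_div ?lt0r_neq0 ?addr_gt0 // => /eqP h; lra.
Qed.

Lemma sinh_eq0 x : sinh x = 0 -> x = 0.
Proof. by move=> s0; apply: tanh_inj; rewrite /tanh s0 sinh0 !mul0r. Qed.

Lemma tanh_surj t : `|t| < 1 -> exists x, tanh x = t.
Proof.
rewrite ltr_norml => /andP[t1 t2].
have t10 : 0 < 1 - t by lra.
have u0 : 0 < (1 + t) / (1 - t) by rewrite divr_gt0 //; lra.
(* The classical formula for artanh t. *)
exists (ln ((1 + t) / (1 - t)) / 2).
have -> y : tanh (y / 2) = (expR y - 1) / (expR y + 1).
  by rewrite tanhE -[_ *+ 2]mulr_natr divfK ?pnatr_eq0.
rewrite lnK ?posrE //.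
by field; lra.
Qed.

End Hyperbolic.

(** * The operators C_{chi,omega} belong to the set {C_alpha} *)

Section CSymmetry.
Variables (R : realType) (H : hilbertType R) (J K : H -> H).
Hypotheses (hJ : fundamental_symmetry J) (hK : fundamental_symmetry K).
Hypothesis hJK : anti_commute J K.

(** By Euler's formula R_omega = cos(omega) R + i sin(omega) RJ, and J(RJ) = -R. *)
Lemma C_chi_omegaE (chi omega : R) :
  C_chi_omega J K chi omega =
  clif J K 0 (cosh chi)%:C (- ('i * (sinh chi * sin omega)%:C))
           (sinh chi * cos omega)%:C.
Proof.
apply/funext => x; rewrite /C_chi_omega /R_omega (op_exp_fundsym hJ).
have -> : (cos omega)%:C *: x + ('i * (sin omega)%:C) *: J x =
    clif J K (cos omega)%:C ('i * (sin omega)%:C) 0 0 x.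
  by rewrite /clif !scale0r !addr0.
rewrite (K_clif hK hJK) -[X in J (_ *: X + _)](clif_id J K).
rewrite !clifZ clifD (J_clif K hJ); congr clif; rewrite !rmorphM; ring.
Qed.

Lemma C_chi_omega0 (omega : R) : C_chi_omega J K 0 omega = J.
Proof.
apply/funext => x; rewrite C_chi_omegaE cosh0 sinh0 !mul0r rmorph0 mulr0 oppr0.
exact: clif_J.
Qed.

Lemma conj_realC (u : R) : (u%:C)^* = u%:C :> R[i].
Proof. exact: conjc_real. Qed.

Lemma conj_i : 'i^* = - 'i :> R[i].
Proof. exact: conjCi. Qed.

Lemma C_chi_omega_in_C_set (S : set (H * H)) (chi omega : R) :
  is_subspace S -> commutes S J -> commutes S K ->
  C_set S J (C_chi_omega J K chi omega).
Proof.
move=> sS /(commutesP _ (fundsymK hJ)) SJ /(commutesP _ (fundsymK hK)) SK.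
have ii : 'i * 'i = -1 :> R[i] by rewrite -expr2 sqrCi.
set c := cosh chi; set s := sinh chi.
have cs : (c%:C ^+ 2 - s%:C ^+ 2 = 1 :> R[i]).
  by rewrite -!rmorphXn -rmorphB cosh2_sinh2.
have trig : (cos omega)%:C ^+ 2 + (sin omega)%:C ^+ 2 = 1 :> R[i].
  by rewrite -!rmorphXn -rmorphD cos2Dsin2.
have sC u : (s * u)%:C = s%:C * u%:C :> R[i] by exact: rmorphM.
have CK x : C_chi_omega J K chi omega (C_chi_omega J K chi omega x) = x.
  rewrite C_chi_omegaE (clif_comp hJ hK hJK) -[RHS](clif_id J K).
  congr clif; try by ring.
  rewrite -/c -/s !sC.
  set co := (cos omega)%:C in trig *; set si := (sin omega)%:C in trig *.
  transitivity (c%:C ^+ 2 + ('i * 'i) * s%:C ^+ 2 * si ^+ 2 - s%:C ^+ 2 * co ^+ 2).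
    by ring.
  rewrite -[RHS]cs ii; transitivity (c%:C ^+ 2 - s%:C ^+ 2 * (co ^+ 2 + si ^+ 2)).
    by ring.
  by rewrite trig mulr1.
split => //.
- by rewrite C_chi_omegaE; exact: clif_bounded.
(* [W] is R_omega. It is a self-adjoint involution, and JC = cosh(chi) I + sinh(chi) W is e^{chi
   W}. *)
- pose W := clif J K 0 0 (cos omega)%:C (- ('i * (sin omega)%:C)).
  have WK x : W (W x) = x.
    rewrite /W (clif_comp hJ hK hJK) -[RHS](clif_id J K).
    congr clif; try by ring.
    set co := (cos omega)%:C in trig *; set si := (sin omega)%:C in trig *.
    rewrite -[RHS]trig; transitivity (co ^+ 2 - ('i * 'i) * si ^+ 2); first by ring.
    by rewrite ii; ring.
  have Wsa x y : inner (W x) y = inner x (W y).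
    rewrite /W (inner_clif hJ hK hJK) !conjC0 !rmorphN !rmorphM /= conj_i !conj_realC.
    by congr (inner x (clif J K _ _ _ _ y)); ring.
  have QE x : (J \o C_chi_omega J K chi omega) x = c%:C *: x + s%:C *: W x.
    rewrite /= C_chi_omegaE (J_clif K hJ) -[X in _ *: X + _](clif_id J K).
    by rewrite /W !clifZ clifD -/c -/s !sC; congr clif; ring.
  split.
    apply/self_adjoint_graphP => x y; rewrite !QE !(innerDl, innerDr).
    by rewrite !(innerZl, innerZr) Wsa !conj_realC.
  clearbody W; move=> x x0; rewrite QE.
  (* Spectral decomposition: JC = e^chi P + e^{-chi} P' with the orthogonal projections P = (I +
     W)/2 and P' = (I - W)/2. The quadratic form of P at x is |x + Wx|^2 / 4, which explains the
     divisor 4. *)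
  pose E := (expR chi / 4)%:C : R[i]; pose E' := (expR (- chi) / 4)%:C : R[i].
  have E0 : 0 < E by rewrite ltcR divr_gt0 ?expR_gt0.
  have E'0 : 0 < E' by rewrite ltcR divr_gt0 ?expR_gt0.
  have -> : inner (c%:C *: x + s%:C *: W x) x =
      E * inner (x + W x) (x + W x) + E' * inner (x - W x) (x - W x).
    rewrite !(innerDl, innerDr, innerNl, innerNr, innerZl, innerZr).
    rewrite (Wsa x (W x)) WK -(Wsa x x).
    have -> : c%:C = 2 * (E + E').
      rewrite -[2]/(2%:R) -(rmorph_nat (real_complex R)) -rmorphD -rmorphM.
      by congr (_%:C); rewrite /c /cosh; field.
    have -> : s%:C = 2 * (E - E').
      rewrite -[2]/(2%:R) -(rmorph_nat (real_complex R)) -rmorphB -rmorphM.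
      by congr (_%:C); rewrite /s /sinh; field.
    by ring.
  (* The two projections of x cannot both vanish: if x + Wx = 0, then x - Wx = 2x. *)
  have [xW|xW] := eqVneq (x + W x) 0; last first.
    by rewrite ltr_pwDl ?mulr_gt0 ?inner_gt0 // mulr_ge0 ?inner_ge0 // ltW.
  rewrite xW inner0l mulr0 add0r mulr_gt0 // inner_gt0 //.
  have -> : x - W x = x *+ 2.
    apply/eqP; rewrite mulr2n -subr_eq0 opprD addrACA subrr add0r -opprD addrC.
    by rewrite xW oppr0.
  by rewrite -scaler_nat scaler_eq0 negb_or x0 andbT pnatr_eq0.
- apply/(commutesP _ CK) => x y Sxy; rewrite C_chi_omegaE.
  exact: clif_graph.
Qed.

End CSymmetry.

(** * Matrices of operators in an orthonormal basis *)

Section Coordinates.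
Variables (R : realType) (G : hilbertType R) (n : nat) (e : 'I_n -> G).
Hypothesis he : orthonormal_basis e.
Implicit Types (g h : G) (M N : 'M[R[i]]_n).

Lemma inner_sum (c : 'I_n -> R[i]) i : inner (\sum_(j < n) c j *: e j) (e i) = c i.
Proof.
have [eo _] := he.
rewrite linear_sumlz (bigD1 i) //= innerZl eo eqxx mulr1 big1 ?addr0 // => j ji.
by rewrite innerZl eo (negbTE ji) mulr0.
Qed.

Lemma basis_decomp g : g = \sum_(i < n) inner g (e i) *: e i.
Proof.
have [_ /(_ g) [c gE]] := he.
by rewrite {1}gE; apply: eq_bigr => i _; rewrite gE inner_sum.
Qed.

Lemma basis_ext g h : (forall i, inner g (e i) = inner h (e i)) -> g = h.
Proof.
by move=> gh; rewrite [g]basis_decomp [h]basis_decomp; apply: eq_bigr => i _; rewrite gh.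
Qed.

Lemma inner_mx_op M g i : inner (mx_op e M g) (e i) = \sum_j M i j * inner g (e j).
Proof. exact: inner_sum. Qed.

Lemma mx_op_lin M (a : R[i]) g h :
  mx_op e M (a *: g + h) = a *: mx_op e M g + mx_op e M h.
Proof.
apply: basis_ext => i; rewrite innerDl innerZl !inner_mx_op mulr_sumr -big_split.
by apply: eq_bigr => j _; rewrite innerDl innerZl /=; ring.
Qed.

Lemma mx_opDl M N g : mx_op e M g + mx_op e N g = mx_op e (M + N) g.
Proof.
apply: basis_ext => i; rewrite innerDl !inner_mx_op -big_split /=.
by apply: eq_bigr => j _; rewrite mxE mulrDl.
Qed.

Lemma mx_opZl (a : R[i]) M g : a *: mx_op e M g = mx_op e (a *: M) g.
Proof.
apply: basis_ext => i; rewrite innerZl !inner_mx_op mulr_sumr.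
by apply: eq_bigr => j _; rewrite mxE mulrA.
Qed.

Lemma mx_opM M N g : mx_op e M (mx_op e N g) = mx_op e (M *m N) g.
Proof.
apply: basis_ext => i; rewrite !inner_mx_op.
under eq_bigr do rewrite inner_mx_op mulr_sumr.
rewrite exchange_big /=; apply: eq_bigr => j _.
by rewrite mxE mulr_suml; apply: eq_bigr => k _; rewrite mulrA.
Qed.

Lemma mx_op1 g : mx_op e 1%:M g = g.
Proof.
apply: basis_ext => i; rewrite inner_mx_op (bigD1 i) //= mxE eqxx mul1r big1 ?addr0 //.
by move=> j ji; rewrite mxE eq_sym (negbTE ji) mul0r.
Qed.

Lemma mx_op_inj M N : mx_op e M = mx_op e N -> M = N.
Proof.
have [eo _] := he => MN; apply/matrixP => i j.
have := congr1 (fun f => inner (f (e j)) (e i)) MN; rewrite !inner_mx_op.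
have colE P : \sum_k P i k * inner (e j) (e k) = P i j :> R[i].
  rewrite (bigD1 j) //= eo eqxx mulr1 big1 ?addr0 // => k kj.
  by rewrite eo eq_sym (negbTE kj) mulr0.
by rewrite !colE.
Qed.

(** This rank-one matrix will move a nonzero coordinate of a boundary value onto an arbitrary vector
    g. *)
Lemma mx_op_rank1 g h (i : 'I_n) :
  mx_op e (\matrix_(k, j) (inner g (e k) * (j == i)%:R)) h = inner h (e i) *: g.
Proof.
apply: basis_ext => k; rewrite inner_mx_op innerZl (bigD1 i) //= mxE eqxx mulr1.
by rewrite big1 ?addr0 1?mulrC // => j ji; rewrite mxE (negbTE ji) mulr0 mul0r.
Qed.

Lemma inner_basis g h : inner g h = \sum_(i < n) inner g (e i) * (inner h (e i))^*.
Proof.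
rewrite [h in LHS]basis_decomp linear_sumr; apply: eq_bigr => i _.
by rewrite [LHS](innerZr (inner h (e i))) mulrC.
Qed.

Lemma mx_op_adj M g h :
  inner (mx_op e M g) h = inner g (mx_op e (map_mx Num.conj M^T) h).
Proof.
rewrite !inner_basis.
under eq_bigr do rewrite inner_mx_op mulr_suml.
under [RHS]eq_bigr do rewrite inner_mx_op rmorph_sum mulr_sumr.
rewrite exchange_big /=; apply: eq_bigr => j _; apply: eq_bigr => i _.
by rewrite !mxE rmorphM /= conjCK; ring.
Qed.

End Coordinates.

(** * Explicit 2x2 matrices *)

Section Matrices22.
Variable R : realType.
Implicit Types a b c d : R[i].

Lemma sum2 (V : nmodType) (F : 'I_2 -> V) : \sum_(i < 2) F i = F 0 + F 1.
Proof. by rewrite big_ord_recl big_ord1; congr (_ + F _); apply/val_inj. Qed.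

Lemma mx2P (M N : 'M[R[i]]_2) :
  [/\ M 0 0 = N 0 0, M 0 1 = N 0 1, M 1 0 = N 1 0 & M 1 1 = N 1 1] -> M = N.
Proof.
case=> M00 M01 M10 M11; apply/matrixP => i j.
have ord2 (k : 'I_2) : k = 0 \/ k = 1.
  by case: k => -[|[|//]] k; [left|right]; apply/val_inj.
by case: (ord2 i) => ->; case: (ord2 j) => ->.
Qed.

Lemma mx22E (M : 'M[R[i]]_2) : M = mx22 (M 0 0) (M 0 1) (M 1 0) (M 1 1).
Proof. by apply: mx2P; split; rewrite mxE. Qed.

Lemma mx22_inj a b c d a' b' c' d' :
  mx22 a b c d = mx22 a' b' c' d' -> [/\ a = a', b = b', c = c' & d = d'].
Proof.
move=> /matrixP E; move: (E 0 0) (E 0 1) (E 1 0) (E 1 1).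
by rewrite !mxE /= => -> -> -> ->.
Qed.

Lemma mx22_mul a b c d a' b' c' d' :
  mx22 a b c d *m mx22 a' b' c' d' =
  mx22 (a * a' + b * c') (a * b' + b * d') (c * a' + d * c') (c * b' + d * d').
Proof. by apply: mx2P; split; rewrite !mxE sum2 !mxE. Qed.

Lemma mx22_scale k a b c d :
  k *: mx22 a b c d = mx22 (k * a) (k * b) (k * c) (k * d).
Proof. by apply: mx2P; split; rewrite !mxE. Qed.

Lemma mx22_add a b c d a' b' c' d' :
  mx22 a b c d + mx22 a' b' c' d' = mx22 (a + a') (b + b') (c + c') (d + d').
Proof. by apply: mx2P; split; rewrite !mxE. Qed.

Lemma mx22_1 : mx22 1 0 0 1 = 1%:M :> 'M[R[i]]_2.
Proof. by apply: mx2P; split; rewrite !mxE. Qed.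

Lemma mx22_adj a b c d :
  map_mx Num.conj (mx22 a b c d)^T = mx22 a^* c^* b^* d^*.
Proof. by apply: mx2P; split; rewrite !mxE. Qed.

End Matrices22.

(** * The algebra generated by the Pauli matrices *)

Section CliffordBoundary.
Variables (R : realType) (G : hilbertType R) (e : 'I_2 -> G).
Hypothesis he : orthonormal_basis e.

Lemma clif_mx_op (a b c d : R[i]) g :
  clif (mx_op e (sigma3 R)) (mx_op e (sigma1 R)) a b c d g =
  mx_op e (mx22 (a + b) (c + d) (c - d) (a - b)) g.
Proof.
rewrite /clif -[g in a *: g](mx_op1 he) -mx22_1 (mx_opM he) !(mx_opZl he) !(mx_opDl he).
congr mx_op; rewrite /sigma1 /sigma3 mx22_mul !mx22_scale !mx22_add.
by congr mx22; ring.
Qed.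

End CliffordBoundary.

(** * Boundary triplets and the extensions A_K *)

Section Boundary.
Variables (R : realType) (H G : hilbertType R) (S : set (H * H)).
Variables (Gam0 Gam1 : H -> G).
Hypotheses (hSsym : symmetric_op S) (hSdense : densely_defined S).
Hypothesis hGam : boundary_triplet S Gam0 Gam1.

Lemma boundary_lin (a : R[i]) p q : op_adjoint S p -> op_adjoint S q ->
  Gam0 (a *: p + q).1 = a *: Gam0 p.1 + Gam0 q.1 /\
  Gam1 (a *: p + q).1 = a *: Gam1 p.1 + Gam1 q.1.
Proof.
case: hGam => l0 l1 _ _; case: p q => [p1 p2] [q1 q2] Sp Sq.
by split; [apply: l0|apply: l1]; [exists p2|exists q2|exists p2|exists q2].
Qed.

Lemma boundary_surj g0 g1 :
  exists p, [/\ op_adjoint S p, Gam0 p.1 = g0 & Gam1 p.1 = g1].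
Proof.
case: hGam => _ _ _ /(_ g0 g1) [f [y Sf] [f0 f1]].
by exists (f, y).
Qed.

Lemma boundary_green p q : op_adjoint S p -> op_adjoint S q ->
  inner p.2 q.1 - inner p.1 q.2 =
  inner (Gam1 p.1) (Gam0 q.1) - inner (Gam0 p.1) (Gam1 q.1).
Proof. by case: hGam => _ _ + _; exact. Qed.

(** Green's form of p in S with any q in S^* is zero. By surjectivity q can be chosen so that the
    form becomes the square of the norm of one boundary value of p. *)
Lemma boundary_eq0 p : S p -> Gam0 p.1 = 0 /\ Gam1 p.1 = 0.
Proof.
move=> Sp; have Sap : op_adjoint S p by case: hSsym => _; exact.
have gr q : op_adjoint S q ->
    inner (Gam1 q.1) (Gam0 p.1) - inner (Gam0 q.1) (Gam1 p.1) = 0.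
  move=> Saq; rewrite -boundary_green // (innerC p.1) (innerC p.2).
  by rewrite (Saq _ Sp) subrr.
have [q [Saq q0 q1]] := boundary_surj 0 (Gam0 p.1).
have [r [Sar r0 r1]] := boundary_surj (Gam1 p.1) 0.
have := gr _ Saq; have := gr _ Sar.
rewrite q0 q1 r0 r1 !inner0l subr0 sub0r => /eqP.
by rewrite oppr_eq0 => /eqP /inner_eq0 -> /inner_eq0 ->.
Qed.

(** In the Cayley coordinates u = [bu] and v = [bv], the boundary condition of A_K reads v = Ku and
    Green's form is diagonal. *)
Let bu f : G := Gam1 f + 'i *: Gam0 f.
Let bv f : G := Gam1 f - 'i *: Gam0 f.

Lemma boundary_uv_surj u v :
  exists p, [/\ op_adjoint S p, bu p.1 = u & bv p.1 = v].
Proof.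
have ii : 'i * 'i = -1 :> R[i] by rewrite -expr2 sqrCi.
(* Solve u - v = 2i Gam0 and u + v = 2 Gam1. *)
have [p [Sp p0 p1]] :=
  boundary_surj (- 'i / 2 *: (u - v)) (2^-1 *: (u + v)).
exists p; split=> //; rewrite /bu /bv p0 p1 scalerA !mulrA mulrN ii opprK mul1r.
  by rewrite -scalerDr addrACA subrr addr0 -mulr2n -(scaler_nat 2 u) scalerA mulVf
    ?pnatr_eq0 ?scale1r.
by rewrite -scalerBr opprB addrC addrA subrK -mulr2n -(scaler_nat 2 v) scalerA mulVf
  ?pnatr_eq0 ?scale1r.
Qed.

Lemma boundary_green_uv p q : op_adjoint S p -> op_adjoint S q ->
  inner p.2 q.1 - inner p.1 q.2 =
  'i / 2 * (inner (bu p.1) (bu q.1) - inner (bv p.1) (bv q.1)).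
Proof.
have ii : 'i * 'i = -1 :> R[i] by rewrite -expr2 sqrCi.
move=> Sp Sq; rewrite boundary_green // /bu /bv.
rewrite !(innerDl, innerDr, innerNl, innerNr, innerZl, innerZr) conj_i.
set a := inner _ _; set b := inner _ _; set c := inner _ _; set d := inner _ _.
transitivity (- ('i * 'i) * (a - b)); first by rewrite ii opprK mul1r.
by field.
Qed.

Variable e : 'I_2 -> G.
Hypothesis he : orthonormal_basis e.
Implicit Types K M : 'M[R[i]]_2.

Local Notation AK K := (op_A S Gam0 Gam1 (mx_op e K)).

Lemma op_AP K p : AK K p <-> op_adjoint S p /\ mx_op e K (bu p.1) = bv p.1.
Proof. by []. Qed.

Lemma mx_op0 K : mx_op e K 0 = 0.
Proof. by rewrite -[X in mx_op e K X](addNr 0) -scaleN1r mx_op_lin // scaleN1r addNr. Qed.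

Lemma sub_op_A K : S `<=` AK K.
Proof.
move=> p Sp; apply/op_AP; split; first by case: hSsym => _; exact.
by have [p0 p1] := boundary_eq0 Sp; rewrite /bu /bv p0 p1 scaler0 subr0 addr0 mx_op0.
Qed.

(** The elements of A_K realise all pairs (w, Kw) of Cayley coordinates. By Green's formula p is in
    the adjoint iff (w, u(p)) = (Kw, v(p)) for all w, that is u(p) = K^* v(p), and K' inverts
    K^*. *)
Lemma op_A_adjoint K K' : K' *m map_mx Num.conj K^T = 1%:M ->
  op_adjoint (AK K) = AK K'.
Proof.
move=> KK'; have K'K := mulmx1C KK'.
apply/seteqP; split=> p.
  move=> Ap; have Sp : op_adjoint S p by exact: op_adjointS (@sub_op_A K) _ Ap.
  apply/op_AP; split => //.
  suff -> : bu p.1 = mx_op e (map_mx Num.conj K^T) (bv p.1).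
    by rewrite mx_opM // KK' mx_op1.
  apply: inner_extr => u.
  have [q [Sq qu qv]] := boundary_uv_surj u (mx_op e K u).
  have := Ap q; rewrite op_AP qu qv => /(_ (conj Sq erefl)) /eqP.
  rewrite -subr_eq0 boundary_green_uv // qu qv mx_op_adj // mulf_eq0 subr_eq0.
  by rewrite mulf_eq0 invr_eq0 pnatr_eq0 /= (negbTE (neq0Ci _)) => /eqP.
case/op_AP => Sp K'p q /op_AP [Sq Kq]; apply/eqP; rewrite -subr_eq0.
rewrite boundary_green_uv // -Kq mx_op_adj // -K'p mx_opM // K'K mx_op1 //.
by rewrite subrr mulr0.
Qed.

(** Every u occurs as a Cayley coordinate of an element of A_K, and its partner is Ku. *)
Lemma op_A_inj K K' : AK K = AK K' -> K = K'.
Proof.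
move=> AKK'; apply: (mx_op_inj he); apply/funext => u.
have [q [Sq qu qv]] := boundary_uv_surj u (mx_op e K u).
have : AK K q by apply/op_AP; rewrite qu qv.
by rewrite AKK' => /op_AP[_]; rewrite qu qv.
Qed.

Lemma op_A_operator K : is_operator (AK K).
Proof.
split; last by move=> x y z [/= Sy _] [/= Sz _]; exact: op_adjoint_fun hSdense Sy Sz.
split.
  by apply: sub_op_A; exact: subspace0 (proj1 (proj1 hSsym)).
move=> a p q /op_AP [Sp Kp] /op_AP [Sq Kq]; apply/op_AP; split.
  by apply: (proj2 (op_adjoint_subspace S)).
have [l0 l1] := boundary_lin a Sp Sq.
have -> : bu (a *: p + q).1 = a *: bu p.1 + bu q.1.
  by rewrite /bu l0 l1 !scalerDr !scalerA addrACA mulrC.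
rewrite mx_op_lin // Kp Kq /bv l0 l1 !scalerDr opprD scalerN !scalerA addrACA.
by rewrite mulrC.
Qed.

Lemma op_A_dense K : densely_defined (AK K).
Proof.
move=> O O0 oO; have [x [Ox [y Sxy]]] := hSdense O0 oO.
by exists x; split => //; exists y; exact: sub_op_A.
Qed.

(** T multiplies both Cayley coordinates by M, so it sends the pair (u, Ku) to (Mu, MKu). With K' =
    K this is the criterion for commutation; with M = sigma3 it serves for J-self-adjointness. *)
Lemma op_A_map K K' M (T : H -> H) :
  (forall x y, op_adjoint S (x, y) -> op_adjoint S (T x, T y)) ->
  intertwines S Gam0 T (mx_op e M) -> intertwines S Gam1 T (mx_op e M) ->
  (forall x y, AK K (x, y) -> AK K' (T x, T y)) <-> K' *m M = M *m K.
Proof.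
move=> ST T0 T1.
have buT x y : op_adjoint S (x, y) -> bu (T x) = mx_op e M (bu x).
  move=> Sxy; have Dx : op_dom (op_adjoint S) x by exists y.
  by rewrite /bu -T0 // -T1 // addrC -mx_op_lin // addrC.
have bvT x y : op_adjoint S (x, y) -> bv (T x) = mx_op e M (bv x).
  move=> Sxy; have Dx : op_dom (op_adjoint S) x by exists y.
  by rewrite /bv -T0 // -T1 // addrC -scaleNr -mx_op_lin // addrC scaleNr.
split=> [AT|KM x y /op_AP /= [Sxy Kxy]].
  apply: (mx_op_inj he); apply/funext => u.
  have [[x y] /= [Sq qu qv]] := boundary_uv_surj u (mx_op e K u).
  have /AT /op_AP [_] /= : AK K (x, y) by apply/op_AP; rewrite qu qv.
  by rewrite (buT _ _ Sq) (bvT _ _ Sq) qu qv !mx_opM.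
apply/op_AP; split; first exact: ST.
by rewrite /= (buT _ _ Sxy) (bvT _ _ Sxy) -Kxy !mx_opM // KM.
Qed.

End Boundary.

(** * Description of the set {C_alpha} *)

Section CSetDescription.
Variables (R : realType) (H : hilbertType R) (J K : H -> H) (S : set (H * H)).
Hypotheses (hJ : fundamental_symmetry J) (hK : fundamental_symmetry K).
Hypothesis hJK : anti_commute J K.
Hypotheses (hSsym : symmetric_op S) (hSsimple : simple_op S).
Hypotheses (hSJ : commutes S J) (hSK : commutes S K).
Variables (G : hilbertType R) (Gam0 Gam1 : H -> G).
Hypothesis hGam : boundary_triplet S Gam0 Gam1.
Variable e : 'I_2 -> G.
Hypothesis he : orthonormal_basis e.
Hypotheses (hJ0 : intertwines S Gam0 J (mx_op e (sigma3 R)))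
           (hJ1 : intertwines S Gam1 J (mx_op e (sigma3 R)))
           (hK0 : intertwines S Gam0 K (mx_op e (sigma1 R)))
           (hK1 : intertwines S Gam1 K (mx_op e (sigma1 R))).

Let SJ := proj1 (commutesP S (fundsymK hJ)) hSJ.
Let SK := proj1 (commutesP S (fundsymK hK)) hSK.

(** The coefficients invert the correspondence of [clif_mx_op], so that this operator of H acts on
    boundary values by the matrix M. *)
Definition mx_lift (M : 'M[R[i]]_2) : H -> H :=
  clif J K ((M 0 0 + M 1 1) / 2) ((M 0 0 - M 1 1) / 2)
           ((M 0 1 + M 1 0) / 2) ((M 0 1 - M 1 0) / 2).

Lemma mx_lift_bounded M : bounded_op (mx_lift M).
Proof. exact: clif_bounded. Qed.

Lemma adjoint_J x y : op_adjoint S (x, y) -> op_adjoint S (J x, J y).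
Proof. exact: op_adjoint_invariant (fundsym_inner hJ) SJ _ _. Qed.

Lemma adjoint_K x y : op_adjoint S (x, y) -> op_adjoint S (K x, K y).
Proof. exact: op_adjoint_invariant (fundsym_inner hK) SK _ _. Qed.

Lemma adjoint_lift M x y :
  op_adjoint S (x, y) -> op_adjoint S (mx_lift M x, mx_lift M y).
Proof.
by apply: clif_graph; [exact: op_adjoint_subspace|exact: adjoint_J|exact: adjoint_K].
Qed.

(** The boundary maps are linear only on the domain of S^*, so each partial sum has to be kept
    inside it. *)
Lemma intertwines_clif (Gam : H -> G) (a b c d : R[i]) :
  linear_on (op_dom (op_adjoint S)) Gam ->
  intertwines S Gam J (mx_op e (sigma3 R)) ->
  intertwines S Gam K (mx_op e (sigma1 R)) ->
  intertwines S Gam (clif J K a b c d) (mx_op e (mx22 (a + b) (c + d) (c - d) (a - b))).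
Proof.
move=> Gl GJ GK f Df; rewrite -(clif_mx_op he).
have DJ g : op_dom (op_adjoint S) g -> op_dom (op_adjoint S) (J g).
  by case=> y Sy; exists (J y); exact: adjoint_J.
have DK g : op_dom (op_adjoint S) g -> op_dom (op_adjoint S) (K g).
  by case=> y Sy; exists (K y); exact: adjoint_K.
have D0 : op_dom (op_adjoint S) 0.
  by exists 0; exact: subspace0 (op_adjoint_subspace S).
have DD (u : R[i]) g h : op_dom (op_adjoint S) g -> op_dom (op_adjoint S) h ->
    op_dom (op_adjoint S) (u *: g + h).
  move=> [y Sy] [z Sz]; exists (u *: y + z).
  exact: (proj2 (op_adjoint_subspace S)) Sy Sz.
have G0 : Gam 0 = 0.
  by rewrite -[X in Gam X](addNr 0) -scaleN1r Gl // scaleN1r addNr.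
have GZ (u : R[i]) g : op_dom (op_adjoint S) g -> Gam (u *: g) = u *: Gam g.
  by move=> Dg; rewrite -[u *: g]addr0 Gl // G0 addr0.
have DZ (u : R[i]) g : op_dom (op_adjoint S) g -> op_dom (op_adjoint S) (u *: g).
  by move=> Dg; rewrite -[u *: g]addr0; exact: DD.
have DD' g h : op_dom (op_adjoint S) g -> op_dom (op_adjoint S) h ->
    op_dom (op_adjoint S) (g + h).
  by move=> Dg Dh; rewrite -[g]scale1r; exact: DD.
have GD g h : op_dom (op_adjoint S) g -> op_dom (op_adjoint S) h ->
    Gam (g + h) = Gam g + Gam h.
  by move=> Dg Dh; rewrite -[g in LHS]scale1r Gl // scale1r.
have Df1 := DJ _ Df; have Df2 := DK _ Df; have Df3 := DJ _ Df2.
have D4 := DZ a _ Df; have D5 := DZ b _ Df1; have D6 := DZ c _ Df2; have D7 := DZ d _ Df3.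
have D8 := DD' _ _ D4 D5; have D9 := DD' _ _ D8 D6.
rewrite /clif !GD ?GZ //.
by rewrite (GJ f) // (GK f) // (GJ (K f)).
Qed.

Lemma mx_lift0 M : intertwines S Gam0 (mx_lift M) (mx_op e M).
Proof.
case: hGam => l0 _ _ _; rewrite [in mx_op e M](mx22E M).
have := intertwines_clif ((M 0 0 + M 1 1) / 2) ((M 0 0 - M 1 1) / 2)
           ((M 0 1 + M 1 0) / 2) ((M 0 1 - M 1 0) / 2) l0 hJ0 hK0.
by congr (intertwines _ _ _ (mx_op e _)); congr mx22; field.
Qed.

Lemma mx_lift1 M : intertwines S Gam1 (mx_lift M) (mx_op e M).
Proof.
case: hGam => _ l1 _ _; rewrite [in mx_op e M](mx22E M).
have := intertwines_clif ((M 0 0 + M 1 1) / 2) ((M 0 0 - M 1 1) / 2)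
           ((M 0 1 + M 1 0) / 2) ((M 0 1 - M 1 0) / 2) l1 hJ1 hK1.
by congr (intertwines _ _ _ (mx_op e _)); congr mx22; field.
Qed.

Lemma clif_lift a b c d :
  clif J K a b c d = mx_lift (mx22 (a + b) (c + d) (c - d) (a - b)).
Proof. by apply/funext => x; rewrite /mx_lift !mxE /=; congr clif; field. Qed.

Lemma J_in_C_set : C_set S J J.
Proof.
rewrite -[X in C_set _ _ X](C_chi_omega0 hJ hK hJK 0).
exact: (C_chi_omega_in_C_set hJ hK hJK _ _ (proj1 (proj1 hSsym))).
Qed.

(** J itself is one of the C_alpha, so A^*J = JA = AJ, and J cancels. *)
Lemma Upsilon_self_adjoint A : Upsilon S J A -> op_adjoint A = A.
Proof.
move=> [[[_ _ AJ] SA] Ac].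
have /(commutesP _ (fundsymK hJ)) AinvJ := Ac _ J_in_C_set.
have [AB BA] := proj1 (op_comp_graphP _ _ (fundsymK hJ)) AJ.
apply/seteqP; split=> -[x y] Axy.
  by have := AinvJ _ _ (BA _ _ Axy); rewrite !(fundsymK hJ).
by have := AB _ _ (AinvJ _ _ Axy); rewrite !(fundsymK hJ).
Qed.

Lemma Upsilon_invariant_J A : Upsilon S J A ->
  forall x y, A (x, y) -> A (J x, J y).
Proof.
move=> [_ Ac]; apply/(commutesP _ (fundsymK hJ)); exact: Ac J_in_C_set.
Qed.

(** K is recovered from operators already known to preserve A: J C_{1,0} = cosh(1) I + sinh(1) K,
    where sinh(1) is nonzero. *)
Lemma Upsilon_invariant_K A : Upsilon S J A ->
  forall x y, A (x, y) -> A (K x, K y).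
Proof.
move=> UA x y Axy; have sA : is_subspace A by case: UA => -[[[]]].
have CC := C_chi_omega_in_C_set hJ hK hJK 1 0 (proj1 (proj1 hSsym)) hSJ hSK.
case: (UA) => _ /(_ _ CC) AC.
have CK : forall x, C_chi_omega J K 1 0 (C_chi_omega J K 1 0 x) = x by case: CC.
move/(commutesP _ CK): AC => /(_ _ _ Axy) /(Upsilon_invariant_J UA).
have JC z : J (C_chi_omega J K 1 0 z) = (cosh 1)%:C *: z + (sinh 1)%:C *: K z.
  rewrite (C_chi_omegaE hJ hK hJK) (J_clif K hJ) sin0 cos0 mulr0 mulr1.
  by rewrite /clif !scale0r rmorph0 mulr0 oppr0 scale0r !addr0.
rewrite !JC => AJC.
have s0 : (sinh 1)%:C != 0 :> R[i].
  apply/eqP => /complexI /sinh_eq0 /eqP; by rewrite oner_eq0.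
have KE z : K z = (sinh 1)%:C^-1 *:
   ((cosh 1)%:C *: z + (sinh 1)%:C *: K z + - (cosh 1)%:C *: z).
  by rewrite addrAC scaleNr subrr add0r scalerA mulVf ?scale1r.
rewrite [K x]KE [K y]KE.
pose p := (sinh 1)%:C^-1 *: (((cosh 1)%:C *: x + (sinh 1)%:C *: K x,
  (cosh 1)%:C *: y + (sinh 1)%:C *: K y) + - (cosh 1)%:C *: (x, y)).
have : A p by apply: subspaceZ => //; apply: subspaceD => //; exact: subspaceZ.
by [].
Qed.

(** Self-adjointness of JC makes C the adjoint of JCJ, and JCJ preserves S. *)
Lemma C_set_adjoint C x y : C_set S J C ->
  op_adjoint S (x, y) -> op_adjoint S (C x, C y).
Proof.
move=> [_ CK [/self_adjoint_graphP JC _] /(commutesP _ CK) SC].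
apply: (@op_adjoint_invariant _ _ _ (J \o C \o J)); last first.
  by move=> u v Suv; exact/SJ/SC/SJ.
by move=> u v; rewrite /= JC (fundsym_inner hJ) /= (fundsymK hJ).
Qed.

Lemma Upsilon_sub_adjoint A q : Upsilon S J A -> A q -> op_adjoint S q.
Proof.
move=> UA; rewrite -[in A q](Upsilon_self_adjoint UA).
by apply: op_adjointS; case: UA => -[].
Qed.

Let form p q := inner (Gam1 p) (Gam0 q) - inner (Gam0 p) (Gam1 q).

(** As A = A^*, the boundary space of A is its own orthogonal complement for the boundary form. *)
Lemma Upsilon_mem A p : Upsilon S J A -> op_adjoint S p ->
  A p <-> (forall q, A q -> form q.1 p.1 = 0).
Proof.
move=> UA Sp; have Asa := Upsilon_self_adjoint UA.
have AS q : A q -> op_adjoint S q by exact: Upsilon_sub_adjoint.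
split=> [Ap q Aq|fA].
  rewrite /form -(boundary_green hGam (AS _ Aq) Sp); apply/eqP; rewrite subr_eq0.
  by move: Ap; rewrite -[in A p]Asa => /(_ _ Aq) ->.
rewrite -Asa => q Aq; apply/eqP; rewrite -subr_eq0.
by rewrite (boundary_green hGam (AS _ Aq) Sp); apply/eqP; exact: fA.
Qed.

(* Invariance under J and K makes the boundary space of A a tensor product
   l (x) G with l a line of C^2, spanned by (a0, a1). *)
Lemma Upsilon_boundary A : Upsilon S J A -> exists a0 a1 : R[i],
  a0 * a0^* + a1 * a1^* != 0 /\
  forall p, op_adjoint S p -> A p <-> a1^* *: Gam0 p.1 = a0^* *: Gam1 p.1.
Proof.
move=> UA; have Asa := Upsilon_self_adjoint UA.
have sA : is_subspace A by case: UA => -[[[]]].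
have AS q : A q -> op_adjoint S q by exact: Upsilon_sub_adjoint.
have Alift M x y : A (x, y) -> A (mx_lift M x, mx_lift M y).
  exact: clif_graph sA (Upsilon_invariant_J UA) (Upsilon_invariant_K UA).
have [eo _] := he.
have e0 i : e i != 0.
  by apply/eqP => ei; have /eqP := eo i i; rewrite ei inner0l eqxx eq_sym oner_eq0.
(* If all boundary values on A vanished, [Upsilon_mem] would put every element of S^* in A,
   including one with Gam0 = [e 0]. *)
have [f [Af f0]] : exists f, A f /\ (Gam0 f.1 != 0 \/ Gam1 f.1 != 0).
  apply: contrapT => /forallNP nA.
  have A0 q : A q -> Gam0 q.1 = 0 /\ Gam1 q.1 = 0.
    move=> Aq; have /not_andP[//|/not_orP[/negP q0 /negP q1]] := nA q.
    by move: q0 q1; rewrite !negbK => /eqP + /eqP.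
  have [p [Sp p0 p1]] := boundary_surj hGam (e 0) 0.
  have /A0 [] : A p.
    by apply/(Upsilon_mem UA Sp) => q /A0 [q0 q1]; rewrite /form q0 q1 !inner0l subr0.
  by rewrite p0 => /eqP; rewrite (negbTE (e0 0)).
have [i fi] : exists i, inner (Gam0 f.1) (e i) != 0 \/ inner (Gam1 f.1) (e i) != 0.
  apply: contrapT => /forallNP ni.
  have fi i : inner (Gam0 f.1) (e i) = 0 /\ inner (Gam1 f.1) (e i) = 0.
    have /not_orP[/negP + /negP] := ni i.
    by rewrite !negbK => /eqP + /eqP.
  case: f0 => /eqP; apply; apply: (basis_ext he) => i; rewrite inner0l;
    by case: (fi i).
set a0 := inner _ _ in fi; set a1 := inner (Gam1 _) _ in fi.
exists a0, a1.
have N0 : a0 * a0^* + a1 * a1^* != 0.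
  rewrite -!normCK paddr_eq0 ?exprn_ge0 // !expf_eq0 /= !normr_eq0.
  by rewrite negb_and; apply/orP.
split=> // p Sp.
(* A is stable under all lifted matrices; the rank-one one picks the coordinate i of the boundary
   values of f and places it on g. *)
have Ag g : exists q, [/\ A q, Gam0 q.1 = a0 *: g & Gam1 q.1 = a1 *: g].
  pose M := \matrix_(k, j) (inner g (e k) * (j == i)%:R) : 'M[R[i]]_2.
  exists (mx_lift M f.1, mx_lift M f.2).
  have Df : op_dom (op_adjoint S) f.1.
    by exists f.2; case: (f) Af => u v /= /AS.
  split=> /=; first by apply: Alift; case: (f) Af.
    by rewrite -(mx_lift0 M Df) mx_op_rank1.
  by rewrite -(mx_lift1 M Df) mx_op_rank1.
have AB q : A q -> a1^* *: Gam0 q.1 = a0^* *: Gam1 q.1.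
  move=> Aq; apply: inner_extr => g; rewrite !innerZr !conjCK.
  have [r [Ar r0 r1]] := Ag g.
  have /eqP := proj1 (Upsilon_mem UA (AS _ Aq)) Aq r Ar.
  by rewrite /form r0 r1 !innerZl subr_eq0 => /eqP.
split=> [/AB //|pB].
(* The line spanned by (a0, a1) is itself neutral: conj(a1) a0 is real. *)
have lag : a1^* * a0 = a0^* * a1.
  have [r [Ar r0 r1]] := Ag (e 0).
  have := AB r Ar; rewrite r0 r1 !scalerA => /(congr1 (inner^~ (e 0))).
  by rewrite !innerZl eo eqxx !mulr1.
set N := a0 * a0^* + a1 * a1^* in N0.
(* The boundary values of q are the orthogonal projection of those of p onto the pairs (a0 g, a1 g).
   By [lag] and the equation satisfied by p, the projection leaves them unchanged. *)
have [q [Aq q0 q1]] := Ag (N^-1 *: (a0^* *: Gam0 p.1 + a1^* *: Gam1 p.1)).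
have p0 : Gam0 q.1 = Gam0 p.1.
  rewrite q0 scalerA mulrC -scalerA scalerDr !scalerA (mulrC a0 a1^*) lag.
  by rewrite (mulrC a0^* a1) -(scalerA a1) -pB scalerA -scalerDl scalerA mulVf ?scale1r.
have p1 : Gam1 q.1 = Gam1 p.1.
  rewrite q1 scalerA mulrC -scalerA scalerDr !scalerA (mulrC a1 a0^*) -lag.
  by rewrite (mulrC a1^* a0) -(scalerA a0) pB scalerA -scalerDl scalerA mulVf ?scale1r.
apply/(Upsilon_mem UA Sp) => r Ar.
by have := proj1 (Upsilon_mem UA (AS _ Aq)) Aq r Ar; rewrite /form p0 p1.
Qed.

Lemma C_set_lift C : Upsilon S J !=set0 -> C_set S J C -> exists M, C = mx_lift M.
Proof.
move=> [A UA] hC; have Asa := Upsilon_self_adjoint UA.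
have [bC CK _ _] := hC.
have AC x y : A (x, y) -> A (C x, C y).
  by case: UA => _ /(_ _ hC) /(commutesP _ CK); exact.
have SC x y : op_adjoint S (x, y) -> op_adjoint S (C x, C y).
  exact: C_set_adjoint.
have sS := op_adjoint_subspace S.
have [a0 [a1 [N0 AE]]] := Upsilon_boundary UA.
pose B f : G := a1^* *: Gam0 f - a0^* *: Gam1 f.
have AB p : op_adjoint S p -> A p <-> B p.1 = 0.
  by move=> Sp; rewrite AE // /B; split=> [->|/subr0_eq //]; rewrite subrr.
have Blin (c : R[i]) p q : op_adjoint S p -> op_adjoint S q ->
    B (c *: p + q).1 = c *: B p.1 + B q.1.
  move=> Sp Sq; have [l0 l1] := boundary_lin hGam c Sp Sq.
  by rewrite /B l0 l1 !scalerDr opprD !scalerN !scalerA addrACA !(mulrC c).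
have Bsurj g : exists p, op_adjoint S p /\ B p.1 = g.
  set N := a0 * a0^* + _ in N0.
  (* B takes the value (|a1|^2 + |a0|^2) N^{-1} g = g on this pair. *)
  have [p [Sp p0 p1]] := boundary_surj hGam (a1 *: (N^-1 *: g)) (- a0 *: (N^-1 *: g)).
  exists p; split=> //; rewrite /B p0 p1 scaleNr scalerN opprK !scalerA -scalerDl.
  by rewrite -!mulrA !mulrA -mulrDl (mulrC _ a1) (mulrC _ a0) addrC mulfV ?scale1r.
have AS q : A q -> op_adjoint S q by exact: Upsilon_sub_adjoint.
have BClin (c : R[i]) p q : op_adjoint S p -> op_adjoint S q ->
    B (C (c *: p + q).1) = c *: B (C p.1) + B (C q.1).
  case: p q => [p1 p2] [q1 q2] /SC Sp /SC Sq.
  by rewrite /= (bounded_op_lin bC) (Blin c _ _ Sp Sq).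
have [h0 [Sh0 Bh0]] := Bsurj (e 0); have [h1 [Sh1 Bh1]] := Bsurj (e 1).
(* The matrix of the map induced by C on the quotient of the domain of S^* by that of A, which B
   identifies with G. *)
pose M : 'M[R[i]]_2 := \matrix_(i, j) inner (B (C (if j == 0 then h0.1 else h1.1))) (e i).
exists M.
have CM x y : op_adjoint S (x, y) -> B (C x) = mx_op e M (B x).
  move=> Sxy; set b0 := inner (B x) (e 0); set b1 := inner (B x) (e 1).
  (* [h] has the same B-value as x, so the two differ by an element of A, whose image under C is
     again killed by B. The trailing zero gives both sums the shape required by [BClin]. *)
  pose h : H * H := b0 *: h0 + (b1 *: h1 + 0).
  have S0 : op_adjoint S 0 by exact: subspace0.
  have Sh1' : op_adjoint S (b1 *: h1 + 0) by apply: (proj2 sS).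
  have Sh : op_adjoint S h by apply: (proj2 sS).
  have B0 : B 0 = 0.
    by have := Blin (- 1) 0 0 S0 S0; rewrite !scaleN1r !addNr.
  have Bh : B h.1 = B x.
    rewrite !Blin // Bh0 Bh1 B0 addr0 [RHS](basis_decomp he) sum2.
    by [].
  have Ad : A (- 1 *: h + (x, y)).
    apply/AB; first exact: (proj2 sS).
    by rewrite Blin // Bh scaleN1r addNr.
  have AC0 q : A q -> B (C q.1) = 0.
    by case: q => u v /AC ACuv; apply: (proj1 (AB (C u, C v) (AS _ ACuv))).
  have BCx : B (C x) = B (C h.1).
    by have := AC0 _ Ad; rewrite BClin // scaleN1r addrC => /subr0_eq.
  have BC0 : B (C 0) = 0.
    by have := BClin (- 1) 0 0 S0 S0; rewrite !scaleN1r !addNr.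
  rewrite BCx /h !BClin // BC0 addr0; apply: (basis_ext he) => i.
  by rewrite inner_mx_op // sum2 !mxE /= innerDl !innerZl -/b0 -/b1 mulrC (mulrC b1).
have BM x y : op_adjoint S (x, y) -> B (mx_lift M x) = mx_op e M (B x).
  move=> Sxy; have Dx : op_dom (op_adjoint S) x by exists y.
  rewrite {1}/B -(mx_lift0 M Dx) -(mx_lift1 M Dx) -scaleNr.
  have mx_opZ c g : mx_op e M (c *: g) = c *: mx_op e M g.
    by rewrite -[c *: g]addr0 mx_op_lin // mx_op0 // addr0.
  by rewrite -mx_opZ addrC -mx_op_lin // addrC scaleNr.
apply: bounded_op_eq_closure hSsimple => //; first exact: mx_lift_bounded.
move=> x [mu /= muR Sx]; apply/subr0_eq.
set d := _ - _.
have dE : (d, mu *: d) = - 1 *: (mx_lift M x, mx_lift M (mu *: x)) + (C x, C (mu *: x)).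
  rewrite (bounded_opZE bC) (bounded_opZE (mx_lift_bounded M)).
  congr (_, _); first by rewrite /= scaleN1r addrC.
  by rewrite /= scaleN1r addrC scalerBr.
have SMx := adjoint_lift M Sx; have SCx := SC _ _ Sx.
have Sd : op_adjoint S (d, mu *: d) by rewrite dE; exact: (proj2 sS).
(* d = Cx - Tx, with T the lift of M, lies in the eigenspace of S^* and is killed by B;
   self-adjointness of A and non-real [mu] then force d = 0. *)
have : A (d, mu *: d).
  apply/AB => //; rewrite dE Blin // (BM _ _ Sx) (CM _ _ Sx).
  by rewrite scaleN1r addNr.
move=> Ad; have : op_adjoint A (d, mu *: d) by rewrite Asa.
move=> /(_ _ Ad) /=; rewrite innerZl innerZr => /eqP.
rewrite -subr_eq0 -mulrBl mulf_eq0 => /orP[|/eqP/inner_eq0//].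
by rewrite subr_eq0 eq_sym -CrealE (negbTE muR).
Qed.

(** On the span of x and Kx, where Jx = x is nonzero, JC acts by the matrix sigma3 M. Positivity and
    symmetry there give the signs of the diagonal and the relation between the off-diagonal entries;
    M^2 = I gives the rest. *)
Lemma C_set_form C : Upsilon S J !=set0 -> C_set S J C -> exists (p : R) (q : R[i]),
  [/\ 0 < p, p%:C ^+ 2 = 1 + q * q^* & C = mx_lift (mx22 p%:C q (- q^*) (- p%:C))].
Proof.
move=> hU hC; have [M CE] := C_set_lift hU hC.
have [eo _] := he.
have [bC CK [/self_adjoint_graphP JCsa JCpos] _] := hC.
have MM : M *m M = 1%:M.
  apply: (mx_op_inj he); apply/funext => g.
  have [[f f'] [Sf <- _]] := boundary_surj hGam g 0.
  have Df : op_dom (op_adjoint S) f by exists f'.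
  have DCf : op_dom (op_adjoint S) (mx_lift M f).
    by exists (mx_lift M f'); exact: adjoint_lift.
  by rewrite -(mx_opM he) (mx_lift0 M Df) (mx_lift0 M DCf) -!CE CK mx_op1.
have [x [Jx x0]] : exists x, J x = x /\ x != 0.
  have [[f f'] /= [Sf f0 _]] := boundary_surj hGam (e 0) 0.
  have Df : op_dom (op_adjoint S) f by exists f'.
  (* This is (I + J)f/2; it is nonzero because its Gam0 is still [e 0]. *)
  exists (mx_lift (mx22 1 0 0 0) f); split.
    rewrite /mx_lift (J_clif K hJ); congr clif; rewrite !mxE /=; ring.
  apply: contraPneq f0 => xE; have := mx_lift0 (mx22 1 0 0 0) Df.
  have G00 : Gam0 0 = 0.
    have S0 := subspace0 (op_adjoint_subspace S).
    by have [+ _] := boundary_lin hGam (- 1) S0 S0; rewrite !scaleN1r !addNr.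
  rewrite xE G00 => /(congr1 (inner^~ (e 0))); rewrite inner_mx_op // sum2 !mxE /=.
  rewrite mul1r mul0r addr0 inner0l => fe0 fe; move/eqP: fe0.
  by rewrite fe eo eqxx oner_eq0.
pose y := K x.
have Jy : J y = - y.
  by apply/esym/eqP; rewrite eqr_oppLR -(anti_commuteE hJK) Jx.
have Ky : K y = x by rewrite /y (fundsymK hK).
(* Eigenvectors of J for the eigenvalues 1 and -1 are orthogonal. *)
have xy : inner x y = 0.
  have : inner x y = - inner x y.
    by rewrite -innerNr -Jy -(fundsym_inner hJ) Jx.
  move/eqP; rewrite -addr_eq0 -mulr2n mulrn_eq0 /= => /eqP; exact.
have yx : inner y x = 0 by rewrite innerC xy conjC0.
have yy : inner y y = inner x x by rewrite /y (fundsym_inner hK) (fundsymK hK).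
have n0 := inner_gt0 x0; set n := inner x x in yy n0.
have y0 : y != 0.
  by apply: contraTneq n0 => y0; rewrite -yy y0 inner0l ltxx.
have JCx : J (C x) = M 0 0 *: x - M 1 0 *: y.
  rewrite CE /mx_lift (J_clif K hJ) /clif Jx -/y Jy scalerN -!addrA.
  rewrite addrA -scalerDl -scalerBl -[- (_ *: y)]scaleNr.
  by congr (_ *: _ + _ *: _); field.
have JCy : J (C y) = M 0 1 *: x - M 1 1 *: y.
  rewrite CE /mx_lift (J_clif K hJ) /clif Jy Ky Jx scalerN -!addrA.
  rewrite addrA -scalerBl -scalerDl addrC -[- (_ *: y)]scaleNr.
  by congr (_ *: _ + _ *: _); field.
have p0 : 0 < M 0 0.
  have := JCpos x x0; rewrite /= JCx innerDl innerNl !innerZl yx mulr0 subr0.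
  by rewrite pmulr_lgt0.
have s0 : 0 < - M 1 1.
  have := JCpos y y0; rewrite /= JCy innerDl innerNl !innerZl xy yy mulr0 add0r -mulNr.
  by rewrite pmulr_lgt0.
have rE : M 1 0 = - (M 0 1)^*.
  have := JCsa x y; rewrite /= JCx JCy !(innerDl, innerDr, innerNl, innerNr).
  rewrite !(innerZl, innerZr) xy yy !mulr0 sub0r subr0 -mulNr => /mulIf h.
  by rewrite -h ?opprK // gt_eqF.
move: MM; rewrite [M in LHS](mx22E M) mx22_mul -mx22_1 rE => /mx22_inj [E00 _ _ E11].
(* The diagonal of M^2 = I shows that both diagonal entries have the same square, and they have
   opposite signs. *)
have sE : M 1 1 = - M 0 0.
  apply/eqP; rewrite -addr_eq0.
  have : (M 0 0 - M 1 1) * (M 1 1 + M 0 0) = 0.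
    transitivity (M 0 0 * M 0 0 - M 1 1 * M 1 1); first by ring.
    apply/eqP; rewrite subr_eq0; apply/eqP/(addIr (M 0 1 * - (M 0 1)^*)).
    by rewrite E00 -E11; ring.
  by move/eqP; rewrite mulf_eq0 gt_eqF //= addr_gt0.
have pE : (complex.Re (M 0 0))%:C = M 0 0 by rewrite RRe_real // gtr0_real.
exists (complex.Re (M 0 0)), (M 0 1); split.
- by rewrite -ltcR pE.
- by rewrite pE -E00; ring.
- by rewrite CE pE {1}(mx22E M) rE sE.
Qed.

End CSetDescription.

(** * Matrix computations with K(zeta, phi, xi, omega) *)

Section KMatrix.
Variable R : realType.
Implicit Types (t zeta phi xi omega : R) (p q r : R[i]).

Lemma conjM p q : (p * q)^* = p^* * q^*.
Proof. exact: rmorphM. Qed.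

Lemma conjN p : (- p)^* = - p^*.
Proof. exact: rmorphN. Qed.

Lemma expiE t : expi t = (cos t)%:C + 'i * (sin t)%:C.
Proof. by rewrite [LHS]complexE complexiE. Qed.

Lemma expiN t : expi (- t) = (expi t)^*.
Proof.
by rewrite !expiE rmorphD rmorphM /= conj_i !conj_realC cosN sinN rmorphN mulrN mulNr.
Qed.

Lemma expiMJ t : expi t * (expi t)^* = 1.
Proof.
have ii : 'i * 'i = -1 :> R[i] by rewrite -expr2 sqrCi.
rewrite -expiN !expiE cosN sinN rmorphN /=.
transitivity ((cos t)%:C ^+ 2 - 'i * 'i * (sin t)%:C ^+ 2 : R[i]); first by ring.
by rewrite ii mulN1r opprK -!rmorphXn -rmorphD cos2Dsin2.
Qed.

Lemma expiDJ t : (expi t)^* = 2 * (cos t)%:C - expi t.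
Proof. by rewrite -expiN !expiE cosN sinN rmorphN /=; ring. Qed.

Lemma expi_neq0 t : expi t != 0.
Proof. by apply: contra_eq_neq (expiMJ t) => ->; rewrite mul0r eq_sym oner_eq0. Qed.

Lemma Kmx_adj zeta phi xi omega :
  Kmx (- zeta) phi xi omega *m map_mx Num.conj (Kmx zeta phi xi omega)^T = 1%:M.
Proof.
have cs : ((cosh zeta)%:C ^+ 2 - (sinh zeta)%:C ^+ 2 = 1 :> R[i]).
  by rewrite -!rmorphXn -rmorphB cosh2_sinh2.
rewrite /Kmx !mx22_scale mx22_adj mx22_mul coshN sinhN -mx22_1 !expiN rmorphN.
rewrite !(conjM, conjN) !conjCK !conj_realC.
have := expiMJ xi; have := expiMJ phi; have := expiMJ omega.
set k := expi xi; set a := expi phi; set w := expi omega => ww aa kk.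
set c := (cosh zeta)%:C in cs *; set s := (sinh zeta)%:C in cs *.
congr mx22; try by ring.
  transitivity ((k * k^*) * ((a * a^*) * c ^+ 2 - (w * w^*) * s ^+ 2)); first by ring.
  by rewrite kk aa ww !mul1r.
transitivity ((k * k^*) * ((a * a^*) * c ^+ 2 - (w * w^*) * s ^+ 2)); first by ring.
by rewrite kk aa ww !mul1r.
Qed.

(** Through [op_A_map] this is the relation A_K^* J = J A_K. *)
Lemma Kmx_sigma3 zeta phi xi omega :
  Kmx (- zeta) phi xi omega *m sigma3 R = sigma3 R *m Kmx zeta phi xi omega.
Proof.
rewrite /Kmx /sigma3 !mx22_scale !mx22_mul coshN sinhN rmorphN /=.
by congr mx22; ring.
Qed.

(** The hypotheses are the entries of the commutator up to constant factors; the sum of e^{i phi}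
    and e^{-i phi} produces the cosine. *)
Lemma Kmx_commute zeta phi xi omega p q r :
  q * (cosh zeta * cos phi)%:C = - (p * (expi omega)^* * (sinh zeta)%:C) ->
  r * (cosh zeta * cos phi)%:C = p * expi omega * (sinh zeta)%:C ->
  q * expi omega * (sinh zeta)%:C = - (r * (expi omega)^* * (sinh zeta)%:C) ->
  Kmx zeta phi xi omega *m mx22 p q r (- p) =
  mx22 p q r (- p) *m Kmx zeta phi xi omega.
Proof.
rewrite (rmorphM _ (cosh zeta)) /= /Kmx -scalemxAl -scalemxAr !mx22_mul !expiN.
rewrite ![(expi phi)^*]expiDJ.
set a := expi phi; set w := expi omega; set co := (cos phi)%:C.
set c := (cosh zeta)%:C; set s := (sinh zeta)%:C => E01 E10 E00.
congr (_ *: _); congr mx22; apply: subr0_eq.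
- transitivity (q * w * s + r * w^* * s); first by ring.
  by rewrite E00 addNr.
- transitivity (- 2 * (q * (c * co) + p * w^* * s)); first by ring.
  by rewrite E01 addNr mulr0.
- transitivity (2 * (r * (c * co) - p * w * s)); first by ring.
  by rewrite E10 subrr mulr0.
- transitivity (- (q * w * s + r * w^* * s)); first by ring.
  by rewrite E00 addNr oppr0.
Qed.

Lemma Kmx_commute_offdiag zeta phi xi omega p q r :
  Kmx zeta phi xi omega *m mx22 p q r (- p) =
  mx22 p q r (- p) *m Kmx zeta phi xi omega ->
  q * (cosh zeta * cos phi)%:C = - (p * (expi omega)^* * (sinh zeta)%:C).
Proof.
rewrite (rmorphM _ (cosh zeta)) /= /Kmx -scalemxAl -scalemxAr !mx22_mul !expiN.
move=> /(scalerI (_ : (expi xi)^* != 0)); rewrite conjC_eq0 expi_neq0 => /(_ isT).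
move=> /mx22_inj [_ + _ _]; rewrite ![(expi phi)^*]expiDJ.
set a := expi phi; set w := expi omega; set co := (cos phi)%:C.
set c := (cosh zeta)%:C; set s := (sinh zeta)%:C => E01.
apply/subr0_eq/(@mulfI _ (- 2)); first by rewrite oppr_eq0 pnatr_eq0.
rewrite mulr0; move/eqP: E01; rewrite -subr_eq0 => /eqP <-; ring.
Qed.

Lemma Kmx_eqN zeta phi xi omega :
  Kmx (- zeta) phi xi omega = Kmx zeta phi xi omega -> zeta = 0.
Proof.
move=> /(scalerI (expi_neq0 _)); rewrite sinhN rmorphN /= => /mx22_inj [_ + _ _].
move=> /(mulfI (expi_neq0 _)) /eqP; rewrite eq_sym -addr_eq0 -mulr2n mulrn_eq0 /=.
by move=> /eqP /complexI /sinh_eq0.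
Qed.

Lemma Kmx_diag_eq zeta phi xi omega :
  Kmx zeta phi xi omega 0 0 = Kmx zeta phi xi omega 1 1 -> cos phi = 0.
Proof.
rewrite !mxE /= => /(mulfI (expi_neq0 _)) /eqP.
rewrite -subr_eq0 expiN expiDJ => /eqP h; apply: (@complexI R).
have : - 2 * (cosh zeta)%:C * (cos phi)%:C = 0 :> R[i] by rewrite -[RHS]h; ring.
move/eqP; rewrite !mulf_eq0 oppr_eq0 pnatr_eq0 /= => /orP[|/eqP //].
by move=> /eqP /complexI /eqP; rewrite gt_eqF // cosh_gt0.
Qed.

Lemma Kmx_sigma1 zeta phi xi omega :
  Kmx zeta phi xi omega *m sigma1 R = sigma1 R *m Kmx zeta phi xi omega ->
  cos phi = 0.
Proof.
move=> /matrixP /(_ 0 1) h; apply: (@Kmx_diag_eq zeta phi xi omega).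
by move: h; rewrite !mxE !sum2 !mxE /= !(mulr0, mul0r, mulr1, mul1r, add0r, addr0).
Qed.

Lemma cos_eq0_pihalf phi : 0 <= phi <= pi -> cos phi = 0 -> phi = pi / 2.
Proof.
by move=> phiB phi0; rewrite -acos0 -phi0 cosK // in_itv.
Qed.

Lemma Kmx_diagE zeta phi xi omega :
  zeta = 0 <-> Kmx zeta phi xi omega =
               expi (- xi) *: mx22 (- expi (- phi)) 0 0 (expi phi).
Proof.
split=> [->|]; first by rewrite /Kmx cosh0 sinh0 !rmorph0 rmorph1 !mulr0 !mulr1 oppr0.
move=> /(scalerI (expi_neq0 _)) /mx22_inj [_ /eqP + _ _].
by rewrite mulf_eq0 (negbTE (expi_neq0 _)) /= => /eqP /complexI /sinh_eq0.
Qed.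

Lemma Kmx_scalarE zeta phi xi omega : 0 <= phi <= pi ->
  zeta = 0 /\ phi = pi / 2 <->
  Kmx zeta phi xi omega = mx22 ('i * expi (- xi)) 0 0 ('i * expi (- xi)).
Proof.
move=> phiB; split=> [[-> ->]|KE].
  have ei : expi (pi / 2) = 'i :> R[i].
    by rewrite expiE cos_pihalf sin_pihalf rmorph0 rmorph1 add0r mulr1.
  rewrite (proj1 (Kmx_diagE _ _ _ _) erefl) (expiN (pi / 2)) ei conj_i opprK mx22_scale.
  by rewrite mulr0 mulrC.
split; last first.
  apply: (cos_eq0_pihalf phiB); apply: (@Kmx_diag_eq zeta phi xi omega).
  by rewrite KE !mxE.
move/matrixP: KE => /(_ 0 1) /eqP; rewrite !mxE /= !mulf_eq0.
by rewrite !(negbTE (expi_neq0 _)) /= => /eqP /complexI /sinh_eq0.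
Qed.

(** [M] is the matrix by which C_{chi,omega} acts on boundary values; multiplied by cosh(zeta)
    cosh(chi), the equation for chi gives the off-diagonal conditions. *)
Lemma Kmx_commute_C_chi_omega zeta phi xi omega chi :
  cos phi * tanh chi = - tanh zeta ->
  let M := mx22 (cosh chi)%:C ((sinh chi)%:C * (expi omega)^*)
                (- ((sinh chi)%:C * expi omega)) (- (cosh chi)%:C) in
  Kmx zeta phi xi omega *m M = M *m Kmx zeta phi xi omega.
Proof.
move=> h /=; have c0 := gt_eqF (cosh_gt0 zeta); have d0 := gt_eqF (cosh_gt0 chi).
have {}h : sinh chi * (cosh zeta * cos phi) = - (cosh chi * sinh zeta).
  transitivity (cos phi * tanh chi * cosh chi * cosh zeta).
    by rewrite /tanh; field; rewrite d0.
  by rewrite h /tanh; field; rewrite c0.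
have {}h : (sinh chi)%:C * (cosh zeta * cos phi)%:C =
    - ((cosh chi)%:C * (sinh zeta)%:C) :> R[i].
  transitivity ((sinh chi * (cosh zeta * cos phi))%:C : R[i]); first exact/esym/rmorphM.
  by rewrite h rmorphN (rmorphM _ (cosh chi)).
apply: Kmx_commute.
- by rewrite mulrAC h; ring.
- by rewrite mulNr mulrAC h; ring.
- by ring.
Qed.

Lemma tanh_solution zeta t : `|tanh zeta| < `|t| ->
  exists! chi : R, t * tanh chi = - tanh zeta.
Proof.
move=> lt; have t0 : t != 0.
  by rewrite -normr_gt0; exact: le_lt_trans (normr_ge0 _) lt.
have [|chi chiE] := @tanh_surj _ (- tanh zeta / t).
  by rewrite normrM normfV normrN ltr_pdivrMr ?mul1r // normr_gt0.
exists chi; split=> [|chi' chi'E]; first by rewrite chiE mulrC divfK.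
by apply: tanh_inj; apply: (mulfI t0); rewrite chi'E chiE mulrC divfK.
Qed.

Lemma tanh_lt_abs zeta t :
  (`|tanh zeta| < `|t|) = (sinh zeta ^+ 2 < (cosh zeta * t) ^+ 2).
Proof.
have c0 := cosh_gt0 zeta.
rewrite /tanh normrM normfV (gtr0_norm c0) ltr_pdivrMr //.
rewrite -[X in _ < _ * X](gtr0_norm c0) -normrM mulrC -ltr_sqr ?nnegrE //.
by rewrite !real_normK ?num_real.
Qed.

(** With u = cosh(zeta) cos(phi) and s = sinh(zeta), the squared modulus of the off-diagonal
    condition is (p^2 - 1)u^2 = p^2 s^2. Hence p^2(u^2 - s^2) = u^2, so either u = s = 0 or s^2 <
    u^2. *)
Lemma Kmx_commute_C_set zeta phi xi omega (p : R) q r :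
  0 < p -> p%:C ^+ 2 = 1 + q * q^* ->
  Kmx zeta phi xi omega *m mx22 p%:C q r (- p%:C) =
  mx22 p%:C q r (- p%:C) *m Kmx zeta phi xi omega ->
  sinh zeta = 0 /\ cos phi = 0 \/ `|tanh zeta| < `|cos phi|.
Proof.
move=> p0 pq /Kmx_commute_offdiag; rewrite tanh_lt_abs.
have c0 := cosh_gt0 zeta; set u := cosh zeta * cos phi; set s := sinh zeta => E.
have uE : u = 0 -> cos phi = 0 by move/eqP; rewrite mulf_eq0 gt_eqF //= => /eqP.
clearbody u s.
have {}E : (p ^+ 2 - 1) * u ^+ 2 = p ^+ 2 * s ^+ 2.
  apply: (@complexI R); rewrite !rmorphM rmorphB !rmorphXn rmorph1 pq addrAC subrr add0r.
  have EJ := congr1 Num.conj E.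
  rewrite !(conjM, conjN) !conjCK !conj_realC in EJ.
  transitivity ((q * u%:C) * (q^* * u%:C)); first by ring.
  rewrite E EJ -[RHS]mul1r -(expiMJ omega); ring.
have [u0|u0] := eqVneq u 0.
  left; move: E; rewrite u0 expr0n mulr0 => /esym/eqP.
  rewrite mulf_eq0 !expf_eq0 /= gt_eqF //= => /eqP ->; split=> //.
  exact: uE.
right; have u2 : 0 < u ^+ 2 by rewrite exprn_even_gt0.
rewrite -(@ltr_pM2l _ (p ^+ 2)) ?exprn_gt0 // -E mulrBl mul1r.
by rewrite ltrBlDr ltrDl.
Qed.

End KMatrix.

(** * Reduction of the claims to the matrix criteria *)

Theorem theorem4p3 (R : realType) (H : hilbertType R) (J Rop : H -> H)
    (S : set (H * H))
    (hJ : fundamental_symmetry J) (hR : fundamental_symmetry Rop)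
    (hJR : anti_commute J Rop)
    (hSsym : symmetric_op S) (hSdense : densely_defined S)
    (hSsimple : simple_op S) (hSdefect : has_defect_numbers S 2)
    (hSJ : commutes S J) (hSR : commutes S Rop)
    (hUps : Upsilon S J !=set0)
    (G : hilbertType R) (Gam0 Gam1 : H -> G)
    (hGam : boundary_triplet S Gam0 Gam1)
    (calJ calR : G -> G)
    (hJ0 : intertwines S Gam0 J calJ) (hJ1 : intertwines S Gam1 J calJ)
    (hR0 : intertwines S Gam0 Rop calR) (hR1 : intertwines S Gam1 Rop calR)
    (e : 'I_2 -> G) (he : orthonormal_basis e)
    (heJ : calJ = mx_op e (sigma3 R)) (heR : calR = mx_op e (sigma1 R))
    (heRJ : (fun g => 'i *: calR (calJ g)) = mx_op e (sigma2 R))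
    (zeta phi xi omega : R)
    (hphi : 0 <= phi <= pi) (hxi : 0 <= xi < 2 * pi)
    (homega : 0 <= omega < 2 * pi) :
  let K := Kmx zeta phi xi omega in
  let A := op_A S Gam0 Gam1 (mx_op e K) in
  let K' := Kmx (- zeta) phi xi omega in
  [/\ Sigma_J S J (op_adjoint A) /\
      op_adjoint A = op_A S Gam0 Gam1 (mx_op e K'),
      (self_adjoint A <-> zeta = 0) /\
      (zeta = 0 <-> K = expi (- xi) *: mx22 (- expi (- phi)) 0 0 (expi phi)),
      (Sigma_J_st S J `\` Upsilon S J) A <-> `|tanh zeta| < `|cos phi|,
      (Upsilon S J A <-> zeta = 0 /\ phi = pi / 2) /\
      (zeta = 0 /\ phi = pi / 2 <->
       K = mx22 ('i * expi (- xi)) 0 0 ('i * expi (- xi))) &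
      `|tanh zeta| < `|cos phi| ->
      (exists! chi : R, cos phi * tanh chi = - tanh zeta) /\
      (forall chi : R, cos phi * tanh chi = - tanh zeta ->
         commutes A (C_chi_omega J Rop chi omega))].
Proof.
move=> K A K'.
subst calJ calR.
have sS : is_subspace S := proj1 (proj1 hSsym).
have adJ x y : op_adjoint S (x, y) -> op_adjoint S (J x, J y).
  exact: (adjoint_J hJ hSJ).
have adR x y : op_adjoint S (x, y) -> op_adjoint S (Rop x, Rop y).
  exact: (adjoint_K hR hSR).
have adjA z : op_adjoint (op_A S Gam0 Gam1 (mx_op e (Kmx z phi xi omega))) =
    op_A S Gam0 Gam1 (mx_op e (Kmx (- z) phi xi omega)).
  by apply: (op_A_adjoint hSsym hGam he); exact: Kmx_adj.
have sigmaA z : Sigma_J S J (op_A S Gam0 Gam1 (mx_op e (Kmx z phi xi omega))).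
  split; last exact: (sub_op_A hSsym hGam he).
  split; first exact: (op_A_operator hSsym hSdense hGam he).
    exact: (op_A_dense hSsym hSdense hGam he).
  (* Both implications are instances of [Kmx_sigma3], for z and for -z. *)
  rewrite adjA; apply/(op_comp_graphP _ _ (fundsymK hJ)); split.
    exact/(op_A_map hGam he _ _ adJ hJ0 hJ1)/Kmx_sigma3.
  apply/(op_A_map hGam he _ _ adJ hJ0 hJ1).
  by have := Kmx_sigma3 (- z) phi xi omega; rewrite opprK.
have selfE : self_adjoint A -> zeta = 0.
  by rewrite /self_adjoint adjA => /(op_A_inj hGam he) /Kmx_eqN.
have phiE := cos_eq0_pihalf hphi.
have commE C M : C_set S J C -> C = mx_lift J Rop M ->
    commutes A C <-> K *m M = M *m K.
  move=> [_ CK _ _] CE; rewrite commutesP // CE; apply: (op_A_map hGam he).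
  - exact: adjoint_lift.
  - exact: (mx_lift0 hJ hR hSJ hSR hGam he hJ0 hR0).
  - exact: (mx_lift1 hJ hR hSJ hSR hGam he hJ1 hR1).
have UpsE : Upsilon S J A -> zeta = 0 /\ phi = pi / 2.
  move=> UA; split; first exact/selfE/(Upsilon_self_adjoint hJ hR hJR hSsym hSJ hSR UA).
  (* Commutation with R forces the diagonal entries of K to agree, so cos(phi) = 0. *)
  have := Upsilon_invariant_K hJ hR hJR hSsym hSJ hSR UA.
  by move/(op_A_map hGam he _ _ adR hR0 hR1)/Kmx_sigma1/phiE.
have liftE C : C_set S J C -> exists M, C = mx_lift J Rop M.
  exact: (C_set_lift hJ hR hJR hSsym hSsimple hSJ hSR hGam he hJ0 hJ1 hR0 hR1 hUps).
have UpsI : zeta = 0 /\ phi = pi / 2 -> Upsilon S J A.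
  move=> /(Kmx_scalarE zeta xi omega hphi) KE; split; first exact: sigmaA.
  move=> C hC; have [M CE] := liftE C hC; apply/(commE _ _ hC CE).
  (* A scalar matrix commutes with the matrix of every C_alpha. *)
  have -> : K = ('i * expi (- xi)) *: 1%:M by rewrite -mx22_1 mx22_scale mulr0 mulr1.
  by rewrite -scalemxAl -scalemxAr mul1mx mulmx1.
have Cset chi : C_set S J (C_chi_omega J Rop chi omega).
  exact: C_chi_omega_in_C_set.
have Ccomm chi : cos phi * tanh chi = - tanh zeta ->
    commutes A (C_chi_omega J Rop chi omega).
  move=> /(Kmx_commute_C_chi_omega xi omega) /= KM.
  refine (proj2 (commE _ _ (Cset chi) _) KM).
  (* In the off-diagonal entries the coefficients of R and JR combine into e^{-i omega} and e^{i
     omega}. *)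
  rewrite (C_chi_omegaE hJ hR hJR) clif_lift add0r sub0r.
  rewrite !(rmorphM _ (sinh chi)) /= -expiN !expiE cosN sinN rmorphN.
  by congr (mx_lift J Rop (mx22 _ _ _ _)); ring.
split.
- by rewrite adjA.
- split; last exact: Kmx_diagE.
  by split=> // z0; rewrite /self_adjoint adjA z0 oppr0 /A /K z0.
- split=> [[[_ [C hC AC]] nU]|lt].
    (* The degenerate alternative zeta = 0, cos(phi) = 0 is the case of Upsilon, which is excluded
       here. *)
    have [p [q [p0 pq CE]]] := C_set_form hJ hR hJR hSsym hSsimple hSJ hSR hGam he
      hJ0 hJ1 hR0 hR1 hUps hC.
    move/(commE _ _ hC CE): AC => /(Kmx_commute_C_set p0 pq) [[s0 c0]|//].
    by case: nU; apply: UpsI; split; [exact: sinh_eq0 | exact: phiE].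
  have [chi [chiE _]] := tanh_solution lt; split.
    by split; [exact: sigmaA | exists (C_chi_omega J Rop chi omega) => //; exact: Ccomm].
  move=> /UpsE [_ phi2]; move: lt.
  by rewrite phi2 cos_pihalf normr0 ltNge normr_ge0.
- by split; [split=> [/UpsE|/UpsI] | exact: Kmx_scalarE].
- by move=> lt; split; [exact: tanh_solution | exact: Ccomm].
Qed.
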